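(* Let $(\mathcal{C},\mathbb{E},\mathfrak{s})$ be an extriangulated category satisfying (WIC), let $\xi$ be a proper class of $\mathbb{E}$-triangles in $\mathcal{C}$, and assume that $\mathcal{C}$ has enough $\xi$-projectives and enough $\xi$-injectives. Let $A\xrightarrow{x}B\xrightarrow{y}C\overset{\delta}{\dashrightarrow}$ be an $\mathbb{E}$-triangle in $\xi$. (1) If $N$ is an object of finite $\xi$-$\mathcal{G}$injective dimension, then there exists a long exact sequence $$\cdots\to\widetilde{\xi{\rm xt}}^n_{\mathcal{I}}(C,N)\xrightarrow{\widetilde{\xi{\rm xt}}^n_{\mathcal{I}}(y,N)}\widetilde{\xi{\rm xt}}^n_{\mathcal{I}}(B,N)\xrightarrow{\widetilde{\xi{\rm xt}}^n_{\mathcal{I}}(x,N)}\widetilde{\xi{\rm xt}}^n_{\mathcal{I}}(A,N)\to\widetilde{\xi{\rm xt}}^{n+1}_{\mathcal{I}}(C,N)\to\cdots.$$ (2) If $A$ and $C$ have finite $\xi$-$\mathcal{G}$injective dimension, then for each $M\in\mathcal{C}$ there exists a long exact sequence $$\cdots\to\widetilde{\xi{\rm xt}}^n_{\mathcal{I}}(M,A)\xrightarrow{\widetilde{\xi{\rm xt}}^n_{\mathcal{I}}(M,x)}\widetilde{\xi{\rm xt}}^n_{\mathcal{I}}(M,B)\xrightarrow{\widetilde{\xi{\rm xt}}^n_{\mathcal{I}}(M,y)}\widetilde{\xi{\rm xt}}^n_{\mathcal{I}}(M,C)\to\widetilde{\xi{\rm xt}}^{n+1}_{\mathcal{I}}(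M,A)\to\cdots.$$
   Context: Extriangulated categories (Nakaoka--Palu). $\mathcal{C}$ is an additive category with an additive bifunctor $\mathbb{E}:\mathcal{C}^{\rm op}\times\mathcal{C}\to{\rm Ab}$. Elements $\delta\in\mathbb{E}(C,A)$ are $\mathbb{E}$-extensions; for $a:A\to A'$ and $c:C'\to C$ write $a_*\delta=\mathbb{E}(C,a)(\delta)$, $c^*\delta=\mathbb{E}(c,A)(\delta)$. A morphism $\delta\to\delta'$ ($\delta\in\mathbb{E}(C,A)$, $\delta'\in\mathbb{E}(C',A')$) is a pair $(a:A\to A',c:C\to C')$ with $a_*\delta=c^*\delta'$. Sequences $A\to B\to C$ and $A\to B'\to C$ are equivalent if there is an isomorphism $B\cong B'$ compatible with the maps. $\mathfrak{s}$ assigns to each $\delta\in\mathbb{E}(C,A)$ an equivalence class $\mathfrak{s}(\delta)=[A\xrightarrow{x}B\xrightarrow{y}C]$ such that every morphism $(a,c)$ of extensions lifts to a commutative $(a,b,c)$, with $\mathfrak{s}(0)=[A\to A\oplus C\to C]$ and $\mathfrak{s}(\delta\oplus\delta')=\mathfrak{s}(\delta)\oplus\mathfrak{s}(\delta')$. Axioms: (ET3) for $\delta,\delta'$ realized by $A\xrightarrow{x}B\xrightarrow{y}C$, $A'\xrightarrow{x'}B'\xrightarrow{y'}C'$ and $a,b$ with $bx=x'a$ there is $c$ with $cy=y'b$ and $a_*\delta=c^*\delta'$; (ET4) if $\delta\in\mathbb{E}(D,A)$ is realized by $A\xrightarrow{f}B\xrightarrow{f'}D$ and $\delta'\in\mathbb{E}(F,B)$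 by $B\xrightarrow{g}C\xrightarrow{g'}F$, there are an object $E$, maps $d:D\to E$, $e:E\to F$, $h':C\to E$ and $\delta''\in\mathbb{E}(E,A)$ realized by $A\xrightarrow{gf}C\xrightarrow{h'}E$ with $h'g=df'$, $eh'=g'$, $D\xrightarrow{d}E\xrightarrow{e}F$ realizing $f'_*\delta'$, $d^*\delta''=\delta$, $f_*\delta''=e^*\delta'$; and the duals of (ET3), (ET4). If $A\xrightarrow{x}B\xrightarrow{y}C$ realizes $\delta$, then $A\xrightarrow{x}B\xrightarrow{y}C\overset{\delta}{\dashrightarrow}$ is an $\mathbb{E}$-triangle, $x$ is an inflation and $y$ a deflation. It is split if $\delta=0$. (WIC): if $gf$ is an inflation then so is $f$; if $gf$ is a deflation then so is $g$. Proper class. A class $\xi$ of $\mathbb{E}$-triangles closed under isomorphisms is proper if: it is closed under finite coproducts and contains all split $\mathbb{E}$-triangles; it is closed under base change ($\delta\mapsto c^*\delta$) and cobase change ($\delta\mapsto a_*\delta$); and it is saturated: for $\mathbb{E}$-triangles $A_i\xrightarrow{x_i}B_i\xrightarrow{y_i}C\overset{\delta_i}{\dashrightarrow}$ ($i=1,2$), if the $\mathbb{E}$-triangles of $\delta_2$ and of $y_2^*\delta_1$ are in $\xi$, then so is that of $\delta_1$. Relative notions. $I$ is $\xi$-injective if $0\to\mathcal{C}(C,I)\to\mathcal{C}(B,I)\to\mathcal{C}(A,I)\to0$ is exact for every $\mathbb{E}$-triangle $A\to B\to C\dashrightarrow$ in $\xi$; $\xi$-projective is dual. $\mathcal{I}(\xi)$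 is the class of $\xi$-injectives. Enough $\xi$-injectives: each $A$ admits an $\mathbb{E}$-triangle $A\to I\to K\dashrightarrow$ in $\xi$ with $I\in\mathcal{I}(\xi)$; enough $\xi$-projectives is dual. Complexes are written homologically. A complex $\mathbf{X}$ is $\xi$-exact if for each $n$ there is an $\mathbb{E}$-triangle $K_{n+1}\xrightarrow{g_n}X_n\xrightarrow{f_n}K_n\dashrightarrow$ in $\xi$ with $d_n=g_{n-1}f_n$. A complete $\xi$-injective coresolution is a $\xi$-exact complex of $\xi$-injectives (indexed by $\mathbb{Z}$) whose $\mathbb{E}$-triangles $K_{n+1}\to I_n\to K_n\dashrightarrow$ can be chosen so that $0\to\mathcal{C}(W,K_{n+1})\to\mathcal{C}(W,I_n)\to\mathcal{C}(W,K_n)\to0$ is exact for all $W\in\mathcal{I}(\xi)$; the objects $K_n$ are then called $\xi$-$\mathcal{G}$injective. The $\xi$-$\mathcal{G}$injective dimension is defined inductively: it is $0$ for $\xi$-$\mathcal{G}$injectives, and $\le n$ for $A$ if there is an $\mathbb{E}$-triangle $A\to G\to K\dashrightarrow$ in $\xi$ with $G$ $\xi$-$\mathcal{G}$injective and $K$ of $\xi$-$\mathcal{G}$injective dimension $\le n-1$. Complete cohomology. A $\xi$-injective coresolution $\iota: N\to\mathbf{I}_N$ is a $\xi$-exact complex $0\to N\to I_0\to I_{-1}\to\cdots$ with $I_n\in\mathcal{I}(\xi)$. $\widetilde{\xi{\rm xt}}^n_{\mathcal{I}}(M,N)=H^n\big(\mathcal{C}(\mathbf{I}_M,\mathbf{I}_N)/\underline{\mathcal{C}}(\mathbf{I}_M,\mathbf{I}_N)\big)$,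 where $\mathcal{C}(\mathbf{X},\mathbf{Y})$ is the Hom complex with $\mathcal{C}(\mathbf{X},\mathbf{Y})_n=\prod_i\mathcal{C}(X_i,Y_{i+n})$, $d(\varphi)_i=d^{\mathbf{Y}}_{i+n}\varphi_i-(-1)^n\varphi_{i-1}d^{\mathbf{X}}_i$, $\underline{\mathcal{C}}$ is the subcomplex of families with $\varphi_i=0$ for $i\ll0$, and $H^n$ is the homology in homological degree $-n$. A $\xi$-complete coresolution of $N$ is a diagram $N\xrightarrow{\iota}\mathbf{I}\xrightarrow{\mu}\mathbf{Q}$ with $\iota$ a $\xi$-injective coresolution, $\mathbf{Q}$ a complete $\xi$-injective coresolution and $\mu$ a chain map with $\mu_i={\rm id}$ for $i\ll0$. It is known that $N$ admits one if and only if it has finite $\xi$-$\mathcal{G}$injective dimension, and that then $\widetilde{\xi{\rm xt}}^n_{\mathcal{I}}(M,N)\cong H^n(\mathcal{C}(M,\mathbf{Q}))$ (cohomology at $\mathcal{C}(M,Q_{-n})$) for all $n\in\mathbb{Z}$ and all $M$, independently of choices and functorially. *)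

(* Defs.v *)
From HB Require Import structures.
From mathcomp Require Import all_boot all_order all_algebra.
From mathcomp Require Import generic_quotient ring_quotient.
From mathcomp Require Import boolp.

Set Implicit Arguments.
Unset Strict Implicit.
Unset Printing Implicit Defensive.

Import Order.TTheory GRing.Theory Num.Theory.
Local Open Scope ring_scope.
Local Open Scope quotient_scope.

(** * Exactness and subquotients of abelian groups *)

Definition exact_at (U V W : zmodType) (f : U -> V) (g : V -> W) : Prop :=
  forall v, g v = 0 <-> exists u, f u = v.

(* 0 -> U -> V -> W -> 0 *)
Definition short_exact (U V W : zmodType) (f : U -> V) (g : V -> W) : Prop :=
  [/\ injective f, exact_at f g & forall w, exists v, g v = w].

Record subgroup (V : zmodType) := Subgroup {
  sg_mem :> V -> Prop;
  sg_0 : sg_mem 0;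
  sg_B : forall u v, sg_mem u -> sg_mem v -> sg_mem (u - v) }.

Section Subquotient.
Variables (V : zmodType) (Z B : subgroup V).

Definition sg_pred : {pred V} := fun v => `[< Z v >].

Lemma sg_pred_closed : zmod_closed sg_pred.
Proof.
split=> [|u v /asboolP hu /asboolP hv]; apply/asboolP; first exact: sg_0.
exact: sg_B.
Qed.
HB.instance Definition _ := GRing.isZmodClosed.Build V sg_pred sg_pred_closed.

Record sg_type := SgType { sg_val : V; sg_valP : sg_val \in sg_pred }.
HB.instance Definition _ := [isSub for sg_val].
HB.instance Definition _ := [Choice of sg_type by <:].
HB.instance Definition _ := [SubChoice_isSubZmodule of sg_type by <:].

Definition sg_sub : {pred sg_type} := fun u => `[< B (val u) >].

Lemma sg_sub_closed : zmod_closed sg_sub.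
Proof.
split=> [|u v /asboolP hu /asboolP hv]; apply/asboolP.
  by rewrite raddf0; exact: sg_0.
by rewrite raddfB; exact: sg_B.
Qed.
HB.instance Definition _ := GRing.isZmodClosed.Build sg_type sg_sub sg_sub_closed.

(* the abelian group Z / (Z \cap B) *)
Definition subquot : zmodType := Quotient.quot sg_sub.

(* the class of v, which is meaningful when Z v holds *)
Definition sq_class (v : V) : subquot := \pi_(Quotient.quot sg_sub) (insubd 0 v).

Definition sq_repr (h : subquot) : V := val (repr (h : Quotient.quot sg_sub)).

Lemma sq_reprP (h : subquot) : Z (sq_repr h).
Proof. exact/asboolP/(valP (repr (h : Quotient.quot sg_sub))). Qed.

Lemma sq_reprK : cancel sq_repr sq_class.
Proof. by move=> h; rewrite /sq_class /sq_repr valKd reprK. Qed.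

Lemma sq_class_eq u v : Z u -> Z v -> (sq_class u = sq_class v <-> B (u - v)).
Proof.
move=> Zu Zv; rewrite /sq_class.
have uE : val (insubd (0 : sg_type) u) = u by rewrite insubdK //; apply/asboolP.
have vE : val (insubd (0 : sg_type) v) = v by rewrite insubdK //; apply/asboolP.
rewrite -[in B _]uE -[in B _]vE -raddfB.
split=> [/eqP|/asboolP h]; last by apply/eqP; rewrite -Quotient.idealrBE.
by rewrite -Quotient.idealrBE => /asboolP.
Qed.

Lemma sq_classB u v : Z u -> Z v -> sq_class (u - v) = sq_class u - sq_class v.
Proof.
move=> Zu Zv; rewrite /sq_class -raddfB; congr (\pi _).
have Zuv : Z (u - v) by exact: sg_B.
by apply: val_inj; rewrite raddfB /= !insubdK //; exact/asboolP.
Qed.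

End Subquotient.

Section SubquotientMap.
Variables (V V' : zmodType) (Z B : subgroup V) (Z' B' : subgroup V').
Variable F : {additive V -> V'}.
Hypothesis FZ : forall v, Z v -> Z' (F v).
Hypothesis FB : forall v, B v -> B' (F v).

Definition sq_fun (h : subquot Z B) : subquot Z' B' := sq_class Z' B' (F (sq_repr h)).

Lemma sq_funE v : Z v -> sq_fun (sq_class Z B v) = sq_class Z' B' (F v).
Proof.
move=> Zv; have Zr := sq_reprP (sq_class Z B v).
apply/(sq_class_eq B' (FZ Zr) (FZ Zv)).
by rewrite -raddfB; apply/FB/(sq_class_eq B Zr Zv); exact: sq_reprK.
Qed.

Lemma sq_fun_additive : zmod_morphism sq_fun.
Proof.
move=> h k; have [Zh Zk] := (sq_reprP h, sq_reprP k).
rewrite -{1}(sq_reprK h) -{1}(sq_reprK k) -sq_classB // sq_funE; last exact: sg_B.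
by rewrite raddfB sq_classB //; exact: FZ.
Qed.

HB.instance Definition _ :=
  GRing.isZmodMorphism.Build (subquot Z B) (subquot Z' B') sq_fun sq_fun_additive.

Definition sq_map : {additive subquot Z B -> subquot Z' B'} := sq_fun.

End SubquotientMap.

(** * Additive categories *)

Record addCat := AddCat {
  obj :> Type;
  mor : obj -> obj -> zmodType;
  hid : forall A, mor A A;
  hcomp : forall A B C, mor B C -> mor A B -> mor A C;
  hcompA : forall A B C D (h : mor C D) (g : mor B C) (f : mor A B),
    hcomp h (hcomp g f) = hcomp (hcomp h g) f;
  hcomp1m : forall A B (f : mor A B), hcomp (hid B) f = f;
  hcompm1 : forall A B (f : mor A B), hcomp f (hid A) = f;
  hcompDl : forall A B C (g g' : mor B C) (f : mor A B),
    hcomp (g + g') f = hcomp g f + hcomp g' f;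
  hcompDr : forall A B C (g : mor B C) (f f' : mor A B),
    hcomp g (f + f') = hcomp g f + hcomp g f';
  zob : obj;
  zob_src : forall A (f : mor zob A), f = 0;
  zob_tgt : forall A (f : mor A zob), f = 0;
  bip : obj -> obj -> obj;
  in1 : forall A B, mor A (bip A B);
  in2 : forall A B, mor B (bip A B);
  pr1 : forall A B, mor (bip A B) A;
  pr2 : forall A B, mor (bip A B) B;
  pr1_in1 : forall A B, hcomp (pr1 A B) (in1 A B) = hid A;
  pr2_in2 : forall A B, hcomp (pr2 A B) (in2 A B) = hid B;
  pr1_in2 : forall A B, hcomp (pr1 A B) (in2 A B) = 0;
  pr2_in1 : forall A B, hcomp (pr2 A B) (in1 A B) = 0;
  bip_id : forall A B,
    hcomp (in1 A B) (pr1 A B) + hcomp (in2 A B) (pr2 A B) = hid (bip A B) }.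

Arguments mor {a} A B.
Arguments hid {a} A.
Arguments hcomp {a A B C} g f.
Arguments zob {a}.
Arguments bip {a} A B.
Arguments in1 {a A B}.
Arguments in2 {a A B}.
Arguments pr1 {a A B}.
Arguments pr2 {a A B}.

Notation "g ∘ f" := (hcomp g f) (at level 40, left associativity) : ring_scope.

Section AdditiveCategory.
Variable C : addCat.

Definition is_iso (A B : C) (f : mor A B) : Prop :=
  exists g : mor B A, g ∘ f = hid A /\ f ∘ g = hid B.

Definition is_zero_ob (A : C) : Prop :=
  (forall B (f : mor A B), f = 0) /\ (forall B (f : mor B A), f = 0).

Definition bip_map (A A' B B' : C) (f : mor A B) (g : mor A' B') :
    mor (bip A A') (bip B B') :=
  in1 ∘ f ∘ pr1 + in2 ∘ g ∘ pr2.

(* Equivalence of the sequences A -> B -> D and A -> B' -> D *)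
Definition seq_equiv (A B B' D : C) (x : mor A B) (y : mor B D)
    (x' : mor A B') (y' : mor B' D) : Prop :=
  exists b : mor B B', [/\ is_iso b, b ∘ x = x' & y' ∘ b = y].

Lemma hcomp0m (A B D : C) (f : mor A B) : (0 : mor B D) ∘ f = 0.
Proof. by apply: (addrI ((0 : mor B D) ∘ f)); rewrite -hcompDl !addr0. Qed.

Lemma hcompm0 (A B D : C) (g : mor B D) : g ∘ (0 : mor A B) = 0.
Proof. by apply: (addrI (g ∘ (0 : mor A B))); rewrite -hcompDr !addr0. Qed.

Lemma hcompBl (A B D : C) (g g' : mor B D) (f : mor A B) :
  (g - g') ∘ f = g ∘ f - g' ∘ f.
Proof. by apply: (addIr (g' ∘ f)); rewrite -hcompDl !subrK. Qed.

Lemma hcompBr (A B D : C) (g : mor B D) (f f' : mor A B) :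
  g ∘ (f - f') = g ∘ f - g ∘ f'.
Proof. by apply: (addIr (g ∘ f')); rewrite -hcompDr !subrK. Qed.

Lemma hcompMzl (A B D : C) (g : mor B D) (f : mor A B) (k : int) :
  (g *~ k) ∘ f = (g ∘ f) *~ k.
Proof.
pose F (h : mor B D) := h ∘ f.
have F_additive : zmod_morphism F by move=> h h'; exact: hcompBl.
pose FM := GRing.isZmodMorphism.Build _ _ F F_additive.
pose FA : {additive mor B D -> mor A D} := HB.pack F FM.
exact: (raddfMz FA).
Qed.

Lemma hcompMzr (A B D : C) (g : mor B D) (f : mor A B) (k : int) :
  g ∘ (f *~ k) = (g ∘ f) *~ k.
Proof.
pose F (h : mor A B) := g ∘ h.
have F_additive : zmod_morphism F by move=> h h'; exact: hcompBr.
pose FM := GRing.isZmodMorphism.Build _ _ F F_additive.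
pose FA : {additive mor A B -> mor A D} := HB.pack F FM.
exact: (raddfMz FA).
Qed.

End AdditiveCategory.

(** * Extriangulated categories *)

(* Additive bifunctors C^op * C -> Ab; [ext D A] is E(D, A), [push a] is a_*
   and [pull c] is c^*. *)
Record extBifunctor (C : addCat) := ExtBifunctor {
  ext : C -> C -> zmodType;
  push : forall D A A', mor A A' -> ext D A -> ext D A';
  pull : forall D D' A, mor D' D -> ext D A -> ext D' A;
  push_addr : forall D A A' (a : mor A A') (d d' : ext D A),
    push a (d + d') = push a d + push a d';
  pull_addr : forall D D' A (c : mor D' D) (d d' : ext D A),
    pull c (d + d') = pull c d + pull c d';
  push_id : forall D A (d : ext D A), push (hid A) d = d;
  pull_id : forall D A (d : ext D A), pull (hid D) d = d;
  push_comp : forall D A A' A'' (a' : mor A' A'') (a : mor A A') (d : ext D A),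
    push (a' ∘ a) d = push a' (push a d);
  pull_comp : forall D D' D'' A (c : mor D' D) (c' : mor D'' D') (d : ext D A),
    pull (c ∘ c') d = pull c' (pull c d);
  push_pull : forall D D' A A' (a : mor A A') (c : mor D' D) (d : ext D A),
    push a (pull c d) = pull c (push a d);
  push_addl : forall D A A' (a a' : mor A A') (d : ext D A),
    push (a + a') d = push a d + push a' d;
  pull_addl : forall D D' A (c c' : mor D' D) (d : ext D A),
    pull (c + c') d = pull c d + pull c' d }.

Arguments ext {C} e D A.
Arguments push {C e D A A'} a d.
Arguments pull {C e D D' A} c d.

Definition ext_sum (C : addCat) (E : extBifunctor C) (A A' D D' : C)
    (d : ext E D A) (d' : ext E D' A') : ext E (bip D D') (bip A A') :=
  push in1 (pull pr1 d) + push in2 (pull pr2 d').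

(* [s x y d] stands for s(d) = [A -x-> B -y-> D]. *)
Definition realization (C : addCat) (E : extBifunctor C) : Type :=
  forall A B D : C, mor A B -> mor B D -> ext E D A -> Prop.

Section RealizationProperties.
Variables (C : addCat) (E : extBifunctor C).
Variable s : realization E.

(* s(d) is one equivalence class of sequences, for every d *)
Definition class_valued : Prop :=
  (forall (A D : C) (d : ext E D A),
     exists (B : C) (x : mor A B) (y : mor B D), s x y d) /\
  (forall (A B B' D : C) (x : mor A B) (y : mor B D)
          (x' : mor A B') (y' : mor B' D) (d : ext E D A),
     s x y d -> (s x' y' d <-> seq_equiv x y x' y')).

Definition lifts_morphisms : Prop :=
  forall (A B D A' B' D' : C) (x : mor A B) (y : mor B D) (d : ext E D A)
         (x' : mor A' B') (y' : mor B' D') (d' : ext E D' A')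
         (a : mor A A') (c : mor D D'),
    s x y d -> s x' y' d' -> push a d = pull c d' ->
    exists b : mor B B', b ∘ x = x' ∘ a /\ y' ∘ b = c ∘ y.

Definition additive_realization : Prop :=
  [/\ class_valued, lifts_morphisms,
      forall A D : C, s (@in1 C A D) (@pr2 C A D) 0
    & forall (A B D A' B' D' : C) (x : mor A B) (y : mor B D) (d : ext E D A)
             (x' : mor A' B') (y' : mor B' D') (d' : ext E D' A'),
        s x y d -> s x' y' d' -> s (bip_map x x') (bip_map y y') (ext_sum d d')].

Definition ET3 : Prop :=
  forall (A B D A' B' D' : C) (x : mor A B) (y : mor B D) (d : ext E D A)
         (x' : mor A' B') (y' : mor B' D') (d' : ext E D' A')
         (a : mor A A') (b : mor B B'),
    s x y d -> s x' y' d' -> b ∘ x = x' ∘ a ->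
    exists c : mor D D', c ∘ y = y' ∘ b /\ push a d = pull c d'.

Definition ET3op : Prop :=
  forall (A B D A' B' D' : C) (x : mor A B) (y : mor B D) (d : ext E D A)
         (x' : mor A' B') (y' : mor B' D') (d' : ext E D' A')
         (b : mor B B') (c : mor D D'),
    s x y d -> s x' y' d' -> y' ∘ b = c ∘ y ->
    exists a : mor A A', x' ∘ a = b ∘ x /\ push a d = pull c d'.

Definition ET4 : Prop :=
  forall (A B X D F : C) (f : mor A B) (f' : mor B D) (d : ext E D A)
         (g : mor B X) (g' : mor X F) (d' : ext E F B),
    s f f' d -> s g g' d' ->
    exists (Y : C) (u : mor D Y) (v : mor Y F) (h' : mor X Y) (d'' : ext E Y A),
      [/\ s (g ∘ f) h' d'', s u v (push f' d'),
          h' ∘ g = u ∘ f' /\ v ∘ h' = g'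
        & pull u d'' = d /\ push f d'' = pull v d'].

Definition ET4op : Prop :=
  forall (A B X D F : C) (f : mor B A) (f' : mor D B) (d : ext E A D)
         (g : mor X B) (g' : mor F X) (d' : ext E B F),
    s f' f d -> s g' g d' ->
    exists (Y : C) (u : mor Y D) (v : mor F Y) (h' : mor Y X) (d'' : ext E A Y),
      [/\ s h' (f ∘ g) d'', s v u (pull f' d'),
          g ∘ h' = f' ∘ u /\ h' ∘ v = g'
        & push u d'' = d /\ pull f d'' = push v d'].

End RealizationProperties.

Record extriCat := ExtriCat {
  ec_cat :> addCat;
  ec_ext : extBifunctor ec_cat;
  ec_real : realization ec_ext;
  ec_additive : additive_realization ec_real;
  ec_ET3 : ET3 ec_real;
  ec_ET3op : ET3op ec_real;
  ec_ET4 : ET4 ec_real;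
  ec_ET4op : ET4op ec_real }.

Section Extriangulated.
Variable C : extriCat.
Local Notation E := (ec_ext C).

Definition etriangle (A B D : C) (x : mor A B) (y : mor B D) (d : ext E D A) : Prop :=
  ec_real x y d.

Definition inflation (A B : C) (x : mor A B) : Prop :=
  exists (D : C) (y : mor B D) (d : ext E D A), etriangle x y d.

Definition deflation (B D : C) (y : mor B D) : Prop :=
  exists (A : C) (x : mor A B) (d : ext E D A), etriangle x y d.

Definition WIC : Prop :=
  (forall (A B D : C) (f : mor A B) (g : mor B D), inflation (g ∘ f) -> inflation f) /\
  (forall (A B D : C) (f : mor A B) (g : mor B D), deflation (g ∘ f) -> deflation g).

(** * Proper classes of E-triangles *)

Definition triClass : Type :=
  forall A B D : C, mor A B -> mor B D -> ext E D A -> Prop.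

Record proper_class (xi : triClass) : Prop := ProperClass {
  proper_etriangle : forall (A B D : C) (x : mor A B) (y : mor B D) (d : ext E D A),
    xi _ _ _ x y d -> etriangle x y d;
  proper_iso : forall (A B D A' B' D' : C)
      (x : mor A B) (y : mor B D) (d : ext E D A)
      (x' : mor A' B') (y' : mor B' D') (d' : ext E D' A')
      (a : mor A A') (b : mor B B') (c : mor D D'),
    xi _ _ _ x y d -> etriangle x' y' d' ->
    is_iso a -> is_iso b -> is_iso c ->
    b ∘ x = x' ∘ a -> c ∘ y = y' ∘ b -> push a d = pull c d' ->
    xi _ _ _ x' y' d';
  proper_split : forall (A B D : C) (x : mor A B) (y : mor B D),
    etriangle x y 0 -> xi _ _ _ x y 0;
  proper_coprod : forall (A B D A' B' D' : C)
      (x : mor A B) (y : mor B D) (d : ext E D A)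
      (x' : mor A' B') (y' : mor B' D') (d' : ext E D' A'),
    xi _ _ _ x y d -> xi _ _ _ x' y' d' ->
    xi _ _ _ (bip_map x x') (bip_map y y') (ext_sum d d');
  proper_base : forall (A B D B' D' : C) (x : mor A B) (y : mor B D) (d : ext E D A)
      (c : mor D' D) (x' : mor A B') (y' : mor B' D'),
    xi _ _ _ x y d -> etriangle x' y' (pull c d) -> xi _ _ _ x' y' (pull c d);
  proper_cobase : forall (A B D A' B' : C) (x : mor A B) (y : mor B D) (d : ext E D A)
      (a : mor A A') (x' : mor A' B') (y' : mor B' D),
    xi _ _ _ x y d -> etriangle x' y' (push a d) -> xi _ _ _ x' y' (push a d);
  proper_saturated : forall (A1 B1 A2 B2 M D : C)
      (x1 : mor A1 B1) (y1 : mor B1 D) (d1 : ext E D A1)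
      (x2 : mor A2 B2) (y2 : mor B2 D) (d2 : ext E D A2)
      (m : mor A1 M) (e : mor M B2),
    etriangle x1 y1 d1 -> xi _ _ _ x2 y2 d2 -> xi _ _ _ m e (pull y2 d1) ->
    xi _ _ _ x1 y1 d1 }.

Variable xi : triClass.

Definition xi_injective (I : C) : Prop :=
  forall (A B D : C) (x : mor A B) (y : mor B D) (d : ext E D A), xi x y d ->
    short_exact (fun h : mor D I => h ∘ y) (fun h : mor B I => h ∘ x).

Definition xi_projective (P : C) : Prop :=
  forall (A B D : C) (x : mor A B) (y : mor B D) (d : ext E D A), xi x y d ->
    short_exact (fun h : mor P A => x ∘ h) (fun h : mor P B => y ∘ h).

Definition enough_xi_injectives : Prop :=
  forall A : C, exists (I K : C) (x : mor A I) (y : mor I K) (d : ext E K A),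
    xi x y d /\ xi_injective I.

Definition enough_xi_projectives : Prop :=
  forall A : C, exists (K P : C) (x : mor K P) (y : mor P A) (d : ext E A K),
    xi x y d /\ xi_projective P.

End Extriangulated.

(** * Complexes *)

(* Homological grading.  The differential is given for all pairs of degrees and
   vanishes unless the degree drops by one, so that no casts along equalities of
   degrees are needed. *)
Record complex (C : addCat) := Complex {
  cx_ob :> int -> C;
  cx_d : forall i j, mor (cx_ob i) (cx_ob j);
  cx_shape : forall i j, i != j + 1 -> cx_d i j = 0;
  cx_dd : forall i j k, cx_d j k ∘ cx_d i j = 0 }.

Record chain_map (C : addCat) (X Y : complex C) := ChainMap {
  cm_map :> forall i, mor (X i) (Y i);
  cm_comm : forall i j, cx_d Y i j ∘ cm_map i = cm_map j ∘ cx_d X i j }.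

(** ** The Hom complex *)

(* Families of morphisms X_i -> Y_j for all i, j.  The group C(X, Y)_m is the
   subgroup [hom_deg m] of the families concentrated on the pairs j = i + m. *)
Definition hom_fam (C : addCat) (X Y : int -> C) : Type :=
  forall i j : int, mor (X i) (Y j).

Section HomFam.
Variables (C : addCat) (X Y : int -> C).
Implicit Types u v w : hom_fam X Y.

HB.instance Definition _ := gen_eqMixin (hom_fam X Y).
HB.instance Definition _ := gen_choiceMixin (hom_fam X Y).

Definition hf_zero : hom_fam X Y := fun _ _ => 0.
Definition hf_opp u : hom_fam X Y := fun i j => - u i j.
Definition hf_add u v : hom_fam X Y := fun i j => u i j + v i j.

Lemma hf_ext u v : (forall i j, u i j = v i j) -> u = v.
Proof. by move=> uv; apply: functional_extensionality_dep => i;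
  apply: functional_extensionality_dep => j. Qed.

Lemma hf_addA : associative hf_add.
Proof. by move=> u v w; apply: hf_ext => i j; exact: addrA. Qed.
Lemma hf_addC : commutative hf_add.
Proof. by move=> u v; apply: hf_ext => i j; exact: addrC. Qed.
Lemma hf_add0 : left_id hf_zero hf_add.
Proof. by move=> u; apply: hf_ext => i j; exact: add0r. Qed.
Lemma hf_addN : left_inverse hf_zero hf_opp hf_add.
Proof. by move=> u; apply: hf_ext => i j; exact: addNr. Qed.

HB.instance Definition _ :=
  GRing.isZmodule.Build (hom_fam X Y) hf_addA hf_addC hf_add0 hf_addN.

Lemma hfBE u v i j : (u - v) i j = u i j - v i j. Proof. by []. Qed.
Lemma hf0E i j : (0 : hom_fam X Y) i j = 0. Proof. by []. Qed.

Definition hom_deg (m : int) u : Prop := forall i j, j != i + m -> u i j = 0.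

(* u_i = 0 for i << 0 *)
Definition vanishes_below u : Prop := exists k : int, forall i j, i <= k -> u i j = 0.

Lemma hom_degB m u v : hom_deg m u -> hom_deg m v -> hom_deg m (u - v).
Proof. by move=> du dv i j ij; rewrite hfBE du ?dv // subr0. Qed.

Lemma vanishes_belowB u v :
  vanishes_below u -> vanishes_below v -> vanishes_below (u - v).
Proof.
move=> [k uk] [l vl]; exists (Order.min k l) => i j.
by rewrite le_min => /andP[ik il]; rewrite hfBE uk ?vl // subr0.
Qed.

Lemma vanishes_below0 : vanishes_below 0.
Proof. by exists 0. Qed.

End HomFam.

Section HomComplex.
Variables (C : addCat) (X Y : complex C).
Implicit Types u v : hom_fam X Y.

(* The differential C(X, Y)_m -> C(X, Y)_(m - 1) *)
Definition hom_d (m : int) u : hom_fam X Y := fun i j =>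
  cx_d Y (j + 1) j ∘ u i (j + 1) - (u (i - 1) j ∘ cx_d X i (i - 1)) *~ (-1) ^+ `|m|%N.


Lemma hom_dB m u v : hom_d m (u - v) = hom_d m u - hom_d m v.
Proof.
apply: hf_ext => i j; rewrite hfBE /hom_d !hfBE hcompBl hcompBr mulrzBl.
by rewrite !opprD !opprK addrACA.
Qed.

Lemma hom_d0 m : hom_d m 0 = 0.
Proof. by rewrite -[X in hom_d m X](subrr 0) hom_dB subrr. Qed.

(* Cocycles and coboundaries of degree n in the quotient of C(X, Y) by the
   subcomplex of the families vanishing below, by means of representatives in
   C(X, Y)_(- n). *)
Definition cocycle (n : int) u : Prop :=
  hom_deg (- n) u /\ vanishes_below (hom_d (- n) u).

Definition coboundary (n : int) u : Prop :=
  hom_deg (- n) u /\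
  exists w : hom_fam X Y,
    hom_deg (- n + 1) w /\ vanishes_below (u - hom_d (- n + 1) w).

Lemma cocycle0 n : cocycle n 0.
Proof. by split=> //; rewrite hom_d0; exact: vanishes_below0. Qed.

Lemma cocycleB n u v : cocycle n u -> cocycle n v -> cocycle n (u - v).
Proof.
move=> [du zu] [dv zv]; split; first exact: hom_degB.
by rewrite hom_dB; exact: vanishes_belowB.
Qed.

Lemma coboundary0 n : coboundary n 0.
Proof.
split=> //; exists 0; split=> //.
by rewrite hom_d0 subrr; exact: vanishes_below0.
Qed.

Lemma coboundaryB n u v : coboundary n u -> coboundary n v -> coboundary n (u - v).
Proof.
move=> [du [w [dw uw]]] [dv [t [dt vt]]]; split; first exact: hom_degB.
exists (w - t); split; first exact: hom_degB.
rewrite hom_dB; have -> : u - v - (hom_d (- n + 1) w - hom_d (- n + 1) t) =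
  (u - hom_d (- n + 1) w) - (v - hom_d (- n + 1) t) by rewrite !opprD !opprK addrACA.
exact: vanishes_belowB.
Qed.

Definition cocycles n := Subgroup (cocycle0 n) (@cocycleB n).
Definition coboundaries n := Subgroup (coboundary0 n) (@coboundaryB n).

(* H^n of the quotient complex *)
Definition quot_cohomology (n : int) : zmodType := subquot (cocycles n) (coboundaries n).

End HomComplex.

(** ** Functoriality of the quotient complex in both arguments *)

Section Precomposition.
Variables (C : addCat) (X X' Y : complex C) (f : chain_map X' X).

Definition precomp (u : hom_fam X Y) : hom_fam X' Y := fun i j => u i j ∘ f i.

Lemma precomp_additive : zmod_morphism precomp.
Proof. by move=> u v; apply: hf_ext => i j; exact: hcompBl. Qed.
HB.instance Definition _ :=
  GRing.isZmodMorphism.Build (hom_fam X Y) (hom_fam X' Y) precomp precomp_additive.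

Lemma precomp_deg m u : hom_deg m u -> hom_deg m (precomp u).
Proof. by move=> du i j ij; rewrite /precomp du // hcomp0m. Qed.

Lemma precomp_vanishes u : vanishes_below u -> vanishes_below (precomp u).
Proof. by move=> [k uk]; exists k => i j ik; rewrite /precomp uk // hcomp0m. Qed.

Lemma precomp_d m u : hom_d m (precomp u) = precomp (hom_d m u).
Proof.
apply: hf_ext => i j; rewrite /hom_d /precomp hcompBl hcompA hcompMzl; congr (_ - _ *~ _).
by rewrite -!hcompA cm_comm.
Qed.

Lemma precomp_cocycle n u : cocycles X Y n u -> cocycles X' Y n (precomp u).
Proof.
move=> [du zu]; split; first exact: precomp_deg.
by rewrite precomp_d; exact: precomp_vanishes.
Qed.

Lemma precomp_coboundary n u : coboundaries X Y n u -> coboundaries X' Y n (precomp u).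
Proof.
move=> [du [w [dw uw]]]; split; first exact: precomp_deg.
exists (precomp w); split; first exact: precomp_deg.
by rewrite precomp_d -raddfB; exact: precomp_vanishes.
Qed.

Definition quot_cohomology_pre n :
    {additive quot_cohomology X Y n -> quot_cohomology X' Y n} :=
  sq_map (@precomp_cocycle n) (@precomp_coboundary n).

End Precomposition.

Section Postcomposition.
Variables (C : addCat) (X Y Y' : complex C) (f : chain_map Y Y').

Definition postcomp (u : hom_fam X Y) : hom_fam X Y' := fun i j => f j ∘ u i j.

Lemma postcomp_additive : zmod_morphism postcomp.
Proof. by move=> u v; apply: hf_ext => i j; exact: hcompBr. Qed.
HB.instance Definition _ :=
  GRing.isZmodMorphism.Build (hom_fam X Y) (hom_fam X Y') postcomp postcomp_additive.

Lemma postcomp_deg m u : hom_deg m u -> hom_deg m (postcomp u).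
Proof. by move=> du i j ij; rewrite /postcomp du // hcompm0. Qed.

Lemma postcomp_vanishes u : vanishes_below u -> vanishes_below (postcomp u).
Proof. by move=> [k uk]; exists k => i j ik; rewrite /postcomp uk // hcompm0. Qed.

Lemma postcomp_d m u : hom_d m (postcomp u) = postcomp (hom_d m u).
Proof.
apply: hf_ext => i j; rewrite /hom_d /postcomp hcompBr hcompMzr !hcompA.
by rewrite cm_comm.
Qed.

Lemma postcomp_cocycle n u : cocycles X Y n u -> cocycles X Y' n (postcomp u).
Proof.
move=> [du zu]; split; first exact: postcomp_deg.
by rewrite postcomp_d; exact: postcomp_vanishes.
Qed.

Lemma postcomp_coboundary n u : coboundaries X Y n u -> coboundaries X Y' n (postcomp u).
Proof.
move=> [du [w [dw uw]]]; split; first exact: postcomp_deg.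
exists (postcomp w); split; first exact: postcomp_deg.
by rewrite postcomp_d -raddfB; exact: postcomp_vanishes.
Qed.

Definition quot_cohomology_post n :
    {additive quot_cohomology X Y n -> quot_cohomology X Y' n} :=
  sq_map (@postcomp_cocycle n) (@postcomp_coboundary n).

End Postcomposition.

(** * Relative homological algebra with respect to xi *)

Section Relative.
Variable C : extriCat.
Local Notation E := (ec_ext C).
Variable xi : triClass C.

(* E-triangles K_(n+1) -g_n-> X_n -f_n-> K_n in xi with d_n = g_(n-1) f_n;
   the relation d_n o d_(n+1) = 0 follows. *)
Definition xi_exact_by (X : int -> C) (d : forall i j, mor (X i) (X j))
    (K : int -> C) (g : forall n, mor (K (n + 1)) (X n)) (f : forall n, mor (X n) (K n))
    (t : forall n, ext E (K n) (K (n + 1))) : Prop :=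
  (forall n, xi (g n) (f n) (t n)) /\ (forall n, d (n + 1) n = g n ∘ f (n + 1)).

Definition xi_exact (X : int -> C) (d : forall i j, mor (X i) (X j)) : Prop :=
  exists K g f t, @xi_exact_by X d K g f t.

(** ** Complete coresolutions and Gorenstein injective dimension *)

Definition complete_coresolution_by (Q : complex C)
    (K : int -> C) (g : forall n, mor (K (n + 1)) (Q n)) (f : forall n, mor (Q n) (K n))
    (t : forall n, ext E (K n) (K (n + 1))) : Prop :=
  [/\ forall n, xi_injective xi (Q n),
      xi_exact_by (cx_d Q) g f t
    & forall (W : C) n, xi_injective xi W ->
        short_exact (fun h : mor W (K (n + 1)) => g n ∘ h) (fun h : mor W (Q n) => f n ∘ h)].

Definition xi_Ginjective (G : C) : Prop :=
  exists Q K g f t n, @complete_coresolution_by Q K g f t /\ G = K n.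

Fixpoint Gid_le (n : nat) (A : C) : Prop :=
  if n is m.+1 then
    exists (G K : C) (x : mor A G) (y : mor G K) (t : ext E K A),
      [/\ xi x y t, xi_Ginjective G & Gid_le m K]
  else xi_Ginjective A.

Definition finite_Gid (A : C) : Prop := exists n, Gid_le n A.

(** ** Coresolutions *)

(* The augmented complex ... 0 -> N -> I_0 -> I_(-1) -> ..., where N sits in
   degree 1, of a complex I and a morphism N -> I_0 *)
Definition aug_ob (N : C) (I : int -> C) (i : int) : C :=
  if i is Posz 1 then N else I i.

Definition aug_d (N : C) (I : int -> C) (d : forall i j, mor (I i) (I j))
    (iota : mor N (I 0)) (i j : int) : mor (aug_ob N I i) (aug_ob N I j) :=
  match i, j return mor (aug_ob N I i) (aug_ob N I j) with
  | Posz 1, Posz 0 => iota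
  | Posz 1, _ => 0
  | _, Posz 1 => 0
  | i, j => d i j
  end.

(* Since I_i = 0 for i > 1, the augmented complex is 0 -> N -> I_0 -> ... *)
Record coresolution (N : C) := Coresolution {
  cr_cx :> complex C;
  cr_zero : forall i : int, 0 < i -> is_zero_ob (cr_cx i);
  cr_inj : forall i : int, i <= 0 -> xi_injective xi (cr_cx i);
  cr_iota : mor N (cr_cx 0);
  cr_exact : xi_exact (aug_d (cx_d cr_cx) cr_iota) }.

(* Chain maps of coresolutions over h : M -> N *)
Record lifting (M N : C) (h : mor M N) (I : coresolution M) (J : coresolution N) :=
  Lifting {
    lf_map :> chain_map I J;
    lf_comm : lf_map 0 ∘ cr_iota I = cr_iota J ∘ h }.

(** ** Complete cohomology *)

(* The complete cohomology group of degree n of (M, N), computed from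
   coresolutions of M and N, and the maps induced on it by h : M' -> M and by
   h : N -> N', computed from a lifting of h. *)
Definition xxt (n : int) (M N : C) (I : coresolution M) (J : coresolution N) : zmodType :=
  quot_cohomology I J n.

Definition xxt_pre (n : int) (M M' N : C) (h : mor M' M)
    (I : coresolution M) (I' : coresolution M') (hI : lifting h I' I)
    (J : coresolution N) : {additive xxt n I J -> xxt n I' J} :=
  quot_cohomology_pre J hI n.

Definition xxt_post (n : int) (M N N' : C) (h : mor N N') (I : coresolution M)
    (J : coresolution N) (J' : coresolution N') (hJ : lifting h J J') :
    {additive xxt n I J -> xxt n I J'} :=
  quot_cohomology_post I hJ n.

End Relative.

(* Main.v *)
Require Import Defs.
From HB Require Import structures.
From mathcomp Require Import all_boot all_order all_algebra.
From mathcomp Require Import boolp zify.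

Set Implicit Arguments.
Unset Strict Implicit.
Unset Printing Implicit Defensive.

Import Order.TTheory GRing.Theory Num.Theory.
Local Open Scope ring_scope.

(** A coresolution is used only through the exactness of its augmentation under
    the functors mor (-) J with J xi-injective; this alone gives the comparison
    theorem for maps into complexes of xi-injectives. For a triangle
    A -> B -> D in xi, one finds a degree -1 cycle w : ID -> IA such that
    IA (+) ID with differential (d_IA, w; 0, d_ID) is again acyclic in this
    sense, with augmentation from B. It is therefore homotopy equivalent to IB,
    compatibly with the given liftings. The sequence IA -> IA (+) ID -> ID is
    split in each degree, so it stays exact in the quotient Hom complexes, in
    either variable, and the long exact sequences follow. *)

(** * Families of morphisms *)

Lemma sgn_pred (m : int) : (-1) ^+ `|m - 1|%N = - (-1) ^+ `|m|%N :> int.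
Proof.
rewrite -(signr_odd _ `|m - 1|) -(signr_odd _ `|m|).
have -> : odd `|m - 1| = ~~ odd `|m| by lia.
by case: (odd _); rewrite ?expr0 ?expr1 ?opprK.
Qed.

Lemma mulrz_sgnK (V : zmodType) (n : nat) (v : V) : v *~ (-1) ^+ n *~ (-1) ^+ n = v.
Proof. by rewrite -mulrzA -expr2 sqrr_sign mulr1z. Qed.

Section Additive.
Variable C : addCat.
Implicit Types X Y Z : complex C.

Lemma hcompNl (A B D : C) (g : mor B D) (f : mor A B) : (- g) ∘ f = - (g ∘ f).
Proof. by rewrite -[- g]add0r hcompBl hcomp0m add0r. Qed.

Lemma hcompNr (A B D : C) (g : mor B D) (f : mor A B) : g ∘ (- f) = - (g ∘ f).
Proof. by rewrite -[- f]add0r hcompBr hcompm0 add0r. Qed.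

Lemma hfDE (X Y : int -> C) (u v : hom_fam X Y) i j : (u + v) i j = u i j + v i j.
Proof. by []. Qed.

Lemma hom_degN (X Y : int -> C) m (u : hom_fam X Y) : hom_deg m u -> hom_deg m (- u).
Proof. by move=> du; rewrite -[- u]sub0r; apply: hom_degB. Qed.

Lemma vanishes_belowN (X Y : int -> C) (u : hom_fam X Y) :
  vanishes_below u -> vanishes_below (- u).
Proof.
by move=> u0; rewrite -[- u]sub0r; apply: vanishes_belowB => //; exact: vanishes_below0.
Qed.

Lemma hom_d_deg X Y m (u : hom_fam X Y) : hom_deg m u -> hom_deg (m - 1) (hom_d m u).
Proof.
move=> du i j ij; rewrite /hom_d !du ?hcomp0m ?hcompm0 ?mul0rz ?subr0 //; lia.
Qed.

Lemma hom_dd X Y m (u : hom_fam X Y) : hom_d (m - 1) (hom_d m u) = 0.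
Proof.
apply: hf_ext => i j; rewrite /hom_d sgn_pred hf0E hcompBr hcompBl.
rewrite hcompMzl hcompMzr -[_ ∘ _ ∘ cx_d X i _ in X in _ - (_ - X *~ _) *~ _]hcompA.
rewrite cx_dd hcompm0 mul0rz.
by rewrite subr0 !hcompA cx_dd hcomp0m sub0r mulrNz opprK addNr.
Qed.

Lemma hom_d_degS X Y m (u : hom_fam X Y) :
  hom_deg (m + 1) u -> hom_deg m (hom_d (m + 1) u).
Proof. by move/hom_d_deg; rewrite addrK. Qed.

Lemma hom_ddS X Y m (u : hom_fam X Y) : hom_d m (hom_d (m + 1) u) = 0.
Proof. by rewrite -[X in hom_d X (hom_d _ _)](addrK 1) hom_dd. Qed.

Lemma hom_d_vanishes X Y m (u : hom_fam X Y) :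
  vanishes_below u -> vanishes_below (hom_d m u).
Proof.
move=> [k uk]; exists k => i j ik.
by rewrite /hom_d !uk ?hcompm0 ?hcomp0m ?mul0rz ?subr0 //; lia.
Qed.

(** Families have entries for all pairs of degrees, so a degreewise morphism needs a cast along
    [i = j]; [eq_axiomK] removes it on the diagonal. *)
Definition deg0_fam (X Y : int -> C) (f : forall i, mor (X i) (Y i)) : hom_fam X Y :=
  fun i j => if i =P j is ReflectT ij then ecast k (mor (X i) (Y k)) ij (f i) else 0.

Lemma deg0_famE (X Y : int -> C) (f : forall i, mor (X i) (Y i)) i :
  deg0_fam f i i = f i.
Proof. by rewrite /deg0_fam; case: eqP => // e; rewrite eq_axiomK. Qed.

Lemma deg0_fam_deg (X Y : int -> C) (f : forall i, mor (X i) (Y i)) :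
  hom_deg 0 (deg0_fam f).
Proof.
move=> i j ij; rewrite /deg0_fam; case: eqP => // e.
by rewrite addr0 e eqxx in ij.
Qed.

Lemma deg0_fam_d X Y (f : chain_map X Y) : hom_d 0 (deg0_fam f) = 0.
Proof.
apply: hf_ext => i j; rewrite hf0E.
have [->|ij] := eqVneq j (i - 1); last first.
  by apply: (hom_d_deg (@deg0_fam_deg _ _ f)); rewrite sub0r.
by rewrite /hom_d subrK !deg0_famE cm_comm mulr1z subrr.
Qed.

(** Lets the recursion of [hom_lift] start from one prescribed entry without casts in its body. *)
Lemma single_fam (X Y : int -> C) i j (v : mor (X i) (Y j)) :
  exists u : hom_fam X Y, u i j = v.
Proof.
exists (fun k l => if i =P k is ReflectT ik then
  if j =P l is ReflectT jl then
    ecast k (mor (X k) (Y l)) ik (ecast l (mor (X i) (Y l)) jl v) else 0 else 0).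
case: eqP => // e; case: eqP => // e'; by rewrite !eq_axiomK.
Qed.

(* The augmented complex 0 -> N -> X_0 -> X_(-1) -> ... becomes exact under
   mor (-) J. *)
Definition acyclic_into (J N : C) X (iota : mor N (X 0)) : Prop :=
  [/\ forall n : mor N J, exists v : mor (X 0) J, v ∘ iota = n,
      forall v : mor (X 0) J, v ∘ iota = 0 ->
        exists t : mor (X (0 - 1)) J, t ∘ cx_d X 0 (0 - 1) = v
    & forall i, i < 0 -> forall v : mor (X i) J, v ∘ cx_d X (i + 1) i = 0 ->
        exists t : mor (X (i - 1)) J, t ∘ cx_d X i (i - 1) = v].

(* u is built from degree 0 downwards, keeping the invariant that d u_i - r_i
   factors through X_i -> X_(i-1). *)
Lemma hom_lift (N : C) X Y (iota : mor N (X 0)) (m : int) (r : hom_fam X Y)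
    (n0 : mor N (Y m)) :
  (forall i, 0 < i -> is_zero_ob (X i)) -> (forall j, acyclic_into (Y j) iota) ->
  hom_deg (m - 1) r -> hom_d (m - 1) r = 0 ->
  cx_d Y m (m - 1) ∘ n0 = r 0 (m - 1) ∘ iota ->
  exists u : hom_fam X Y, [/\ hom_deg m u, hom_d m u = r & u 0 m ∘ iota = n0].
Proof.
move=> X0 acy r_deg r_d n0P; pose e : int := (-1) ^+ `|m|%N.
have [u0 u0P] : exists u0 : mor (X 0) (Y m), u0 ∘ iota = n0.
  by have [surj _ _] := acy m; exact: surj.
have [base baseP] := single_fam u0.
(* The choice is made for every [s], with value 0 when the equation has no solution, so that the
   recursion [T] carries no proofs. The factor [e] comes from solving [hom_d m u = r] for the lower
   component. *)
have G i j (s : mor (X (i + 1)) (Y (j + 1))) : {t : mor (X i) (Y j) |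
    (exists t' : mor (X i) (Y j),
       t' ∘ cx_d X (i + 1) i = cx_d Y (j + 1) j ∘ s - r (i + 1) j) ->
    t ∘ cx_d X (i + 1) i = (cx_d Y (j + 1) j ∘ s - r (i + 1) j) *~ e}.
  apply: cid; case: (pselect (exists t' : mor (X i) (Y j),
    t' ∘ cx_d X (i + 1) i = cx_d Y (j + 1) j ∘ s - r (i + 1) j)) => [[t' t'P]|nex].
    by exists (t' *~ e) => _; rewrite hcompMzl t'P.
  by exists 0 => /nex.
(* [T n] is meant in source degree [- n] and target degree [m - n]; elsewhere its values are
   arbitrary. *)
pose T := fix T n : hom_fam X Y := if n is p.+1 then
  fun i j => sval (G i j (T p (i + 1) (j + 1))) else base.
have ext n i j : i = - n%:Z -> j = i + m - 1 -> exists t : mor (X (i - 1)) (Y j),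
    t ∘ cx_d X i (i - 1) = cx_d Y (j + 1) j ∘ T n i (j + 1) - r i j.
  elim: n i j => [|n IHn] i j.
    rewrite oppr0 => -> ->; rewrite (add0r m) subrK /= baseP.
    have [_ ex0 _] := acy (m - 1); apply: ex0.
    by rewrite hcompBl -hcompA u0P n0P subrr.
  move=> iE jE; have := IHn (i + 1) (j + 1).
  rewrite addrK => /(_ _ _) IH.
  have {}IH := IH ltac:(lia) ltac:(lia).
  have E : T n.+1 i (j + 1) ∘ cx_d X (i + 1) i =
      (cx_d Y (j + 1 + 1) (j + 1) ∘ T n (i + 1) (j + 1 + 1) - r (i + 1) (j + 1)) *~ e.
    by rewrite /=; case: (G _ _ _) => t /= ->.
  have [_ _ exi] := acy j; apply: exi; first lia.
  (* The component just chosen solves its equation by induction; what remains of the composite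
     cancels because [r] is a cycle. *)
  rewrite hcompBl -hcompA E hcompMzr hcompBr hcompA cx_dd hcomp0m sub0r.
  have := congr1 (fun f : hom_fam X Y => f (i + 1) j) r_d.
  rewrite /hom_d hf0E sgn_pred addrK mulrNz opprK => /eqP.
  rewrite addr_eq0 => /eqP ->; rewrite opprK.
  by rewrite mulrz_sgnK subrr.
pose u : hom_fam X Y := fun i j => if j == i + m then
  match i with Posz 0 => T 0%N i j | Posz _ => 0 | Negz n => T n.+1 i j end else 0.
have uE n i j : i = - n%:Z -> j = i + m -> u i j = T n i j.
  by move=> -> ->; rewrite /u eqxx; case: n.
have u_deg : hom_deg m u by move=> i j ij; rewrite /u (negbTE ij).
exists u; split=> //; last by rewrite (uE 0%N) ?add0r //= baseP.
apply: hf_ext => i j; have [jE|ij] := eqVneq j (i + m - 1); last first.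
  rewrite r_deg ?addrA //; apply: (hom_d_deg u_deg); by rewrite addrA.
case: (ltP 0 i) => [/X0[]|i0]; first by
  move=> z _; rewrite (z _ (r i j)) (z _ (hom_d m u i j)).
have [n iE] : exists n : nat, i = - n%:Z by exists `|i|%N; lia.
have [k ik] : exists k, i = k + 1 by exists (i - 1); lia.
rewrite {i}ik in i0 iE jE *; have := ext n _ _ iE jE; rewrite /hom_d addrK.
rewrite (uE n) ?(uE n.+1); [|lia..] => exT.
have := svalP (G k j (T n (k + 1) (j + 1))) exT => /= ->.
by rewrite mulrz_sgnK subKr.
Qed.

End Additive.

(** * Homotopies and comparison of resolutions *)

Definition homotopic (C : addCat) (X Y : complex C) (f g : chain_map X Y) : Prop :=
  exists h : hom_fam X Y, forall i,
    f i - g i = cx_d Y (i + 1) i ∘ h i (i + 1) + h (i - 1) i ∘ cx_d X i (i - 1).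

Lemma sgn_succ (m : int) : (-1) ^+ `|(m + 1)%R|%N = - (-1) ^+ `|m|%N :> int.
Proof. by rewrite -[in RHS](addrK 1 m) sgn_pred opprK. Qed.

(** * Homotopy invariance of the maps induced on cohomology *)

Section CohomologyMaps.
Variables (C : addCat) (X X' Y Y' : complex C) (n : int).

Lemma quot_cohomology_preE (f : chain_map X' X) u : cocycles X Y n u ->
  quot_cohomology_pre Y f n (sq_class _ (coboundaries X Y n) u) =
  sq_class _ (coboundaries X' Y n) (precomp f u).
Proof.
exact: (sq_funE (precomp_cocycle f (n := n)) (precomp_coboundary f (n := n))).
Qed.

Lemma quot_cohomology_postE (f : chain_map Y Y') u : cocycles X Y n u ->
  quot_cohomology_post X f n (sq_class _ (coboundaries X Y n) u) =
  sq_class _ (coboundaries X Y' n) (postcomp f u).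
Proof.
exact: (sq_funE (postcomp_cocycle f (n := n)) (postcomp_coboundary f (n := n))).
Qed.

(** The difference is u d h + u h d; in low degrees the cocycle relation turns u d into d u up to
    sign, and the sum becomes the boundary of u h up to sign. *)
Lemma quot_cohomology_pre_homotopic (f g : chain_map X' X) :
  homotopic f g -> quot_cohomology_pre Y f n =1 quot_cohomology_pre Y g n.
Proof.
move=> [h hP] c; rewrite -(sq_reprK c); have := sq_reprP c.
move: (sq_repr c) => u Zu; rewrite !quot_cohomology_preE //.
apply/sq_class_eq; try exact: precomp_cocycle.
have [u_deg [k du0]] := Zu.
split; first by apply: hom_degB; exact: precomp_deg.
(* The sign cancels the one in the cocycle relation of [u]. *)
exists (fun i j => (u (i + 1) j ∘ h i (i + 1)) *~ (-1) ^+ `|- n|%N); split.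
  by move=> i j ij; rewrite u_deg ?hcomp0m ?mul0rz //; lia.
(* The cocycle relation is used in source degree [i + 1], which must be at most [k]. *)
exists (k - 1) => i j ik; rewrite hfBE /hom_d sgn_succ.
have := du0 (i + 1) j; rewrite /hom_d addrK => /(_ _)/subr0_eq d_u.
rewrite subrK hcompMzr hcompA d_u; last by lia.
rewrite !hcompMzl mulrz_sgnK mulrNz mulrz_sgnK opprK hfBE /precomp -hcompBr hP.
by rewrite hcompDr !hcompA subrr.
Qed.

Lemma quot_cohomology_post_homotopic (f g : chain_map Y Y') :
  homotopic f g -> quot_cohomology_post X f n =1 quot_cohomology_post X g n.
Proof.
move=> [h hP] c; rewrite -(sq_reprK c); have := sq_reprP c.
move: (sq_repr c) => u Zu; rewrite !quot_cohomology_postE //.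
apply/sq_class_eq; try exact: postcomp_cocycle.
have [u_deg [k du0]] := Zu.
split; first by apply: hom_degB; exact: postcomp_deg.
(* No sign here: the second term of [hom_d] already carries the one that turns u d into d u. *)
exists (fun i j => h (j - 1) j ∘ u i (j - 1)); split.
  by move=> i j ij; rewrite u_deg ?hcompm0 //; lia.
exists k => i j ik; rewrite hfBE /hom_d sgn_succ addrK mulrNz opprK.
have := du0 i (j - 1) ik; rewrite /hom_d subrK => /subr0_eq d_u.
rewrite -hcompA -hcompMzr -d_u hfBE /postcomp -hcompBl hP.
by rewrite hcompDl !hcompA subrr.
Qed.

End CohomologyMaps.

Definition cm_comp (C : addCat) (X Y Z : complex C) (g : chain_map Y Z)
    (f : chain_map X Y) : chain_map X Z.
Proof.
exists (fun i => g i ∘ f i) => i j.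
by rewrite hcompA cm_comm -hcompA cm_comm hcompA.
Defined.

Definition cm_id (C : addCat) (X : complex C) : chain_map X X.
Proof. by exists (fun i => hid (X i)) => i j; rewrite hcompm1 hcomp1m. Defined.

Section Functoriality.
Variables (C : addCat) (X Y Z W : complex C) (g : chain_map Y Z) (f : chain_map X Y).
Variable n : int.

Lemma quot_cohomology_pre_comp c :
  quot_cohomology_pre W (cm_comp g f) n c =
  quot_cohomology_pre W f n (quot_cohomology_pre W g n c).
Proof.
rewrite -(sq_reprK c); have Zu := sq_reprP c.
rewrite !quot_cohomology_preE //; last exact: precomp_cocycle.
by congr sq_class; apply: hf_ext => i j; exact: hcompA.
Qed.

Lemma quot_cohomology_post_comp c :
  quot_cohomology_post W (cm_comp g f) n c =
  quot_cohomology_post W g n (quot_cohomology_post W f n c).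
Proof.
rewrite -(sq_reprK c); have Zu := sq_reprP c.
rewrite !quot_cohomology_postE //; last exact: postcomp_cocycle.
by congr sq_class; apply: hf_ext => i j; rewrite /postcomp hcompA.
Qed.

Lemma quot_cohomology_pre_id c : quot_cohomology_pre W (cm_id X) n c = c.
Proof.
rewrite -[in RHS](sq_reprK c) -[in LHS](sq_reprK c) quot_cohomology_preE.
  by congr sq_class; apply: hf_ext => i j; exact: hcompm1.
exact: sq_reprP.
Qed.

Lemma quot_cohomology_post_id c : quot_cohomology_post W (cm_id X) n c = c.
Proof.
rewrite -[in RHS](sq_reprK c) -[in LHS](sq_reprK c) quot_cohomology_postE.
  by congr sq_class; apply: hf_ext => i j; exact: hcomp1m.
exact: sq_reprP.
Qed.

End Functoriality.

(** * Existence and uniqueness of chain maps over a given augmentation *)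

Section Comparison.
Variables (C : addCat) (N : C) (X Y : complex C) (iota : mor N (X 0)).
Hypothesis X_bounded : forall i, 0 < i -> is_zero_ob (X i).
Hypothesis X_acyclic : forall j, acyclic_into (Y j) iota.

(** A chain map is a cycle of degree 0: [hom_lift] with [m = 0] and [r = 0]. *)
Lemma comparison_exists (n0 : mor N (Y 0)) :
  cx_d Y 0 (0 - 1) ∘ n0 = 0 -> exists f : chain_map X Y, f 0 ∘ iota = n0.
Proof.
move=> dn0; have [//|||u [u_deg u_d u0]] :=
  @hom_lift C N X Y iota 0 0 n0 X_bounded X_acyclic.
- exact: hom_d0.
- by rewrite dn0 hf0E hcomp0m.
have u_comm i j : cx_d Y i j ∘ u i i = u j j ∘ cx_d X i j.
  have [->|ij] := eqVneq i (j + 1); last first.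
    by rewrite !cx_shape // hcomp0m hcompm0.
  have := congr1 (fun v : hom_fam X Y => v (j + 1) j) u_d.
  by rewrite /hom_d hf0E mulr1z addrK => /subr0_eq.
by exists (ChainMap u_comm).
Qed.

(** A homotopy is a degree 1 family with boundary f - g; [hom_lift] with [m = 1] can start from 0
    because the maps agree on the augmentation. *)
Lemma comparison_unique (f g : chain_map X Y) :
  f 0 ∘ iota = g 0 ∘ iota -> homotopic f g.
Proof.
move=> fg; pose r := deg0_fam f - deg0_fam g.
have [||| h [_ h_d _]] := @hom_lift C N X Y iota 1 r 0 X_bounded X_acyclic.
- by rewrite subrr; apply: hom_degB; exact: deg0_fam_deg.
- by rewrite subrr hom_dB !deg0_fam_d subrr.
- by rewrite subrr hcompm0 /r hfBE !deg0_famE hcompBl fg subrr.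
exists h => i; have := congr1 (fun v : hom_fam X Y => v i i) h_d.
by rewrite /hom_d /r hfBE !deg0_famE expr1 mulrNz mulr1z opprK.
Qed.

End Comparison.

(** * The twisted sum of two resolutions *)

Section Biproduct.
Variables (C : addCat) (A B : C).

Lemma pr1_in1K (W : C) (f : mor W A) : @pr1 C A B ∘ (@in1 C A B ∘ f) = f.
Proof. by rewrite hcompA (pr1_in1 A B) hcomp1m. Qed.

Lemma pr2_in2K (W : C) (f : mor W B) : @pr2 C A B ∘ (@in2 C A B ∘ f) = f.
Proof. by rewrite hcompA (pr2_in2 A B) hcomp1m. Qed.

Lemma pr1_in2K (W : C) (f : mor W B) : @pr1 C A B ∘ (@in2 C A B ∘ f) = 0.
Proof. by rewrite hcompA pr1_in2 hcomp0m. Qed.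

Lemma pr2_in1K (W : C) (f : mor W A) : @pr2 C A B ∘ (@in1 C A B ∘ f) = 0.
Proof. by rewrite hcompA pr2_in1 hcomp0m. Qed.

Definition bipK :=
  (pr1_in1, pr2_in2, pr1_in2, pr2_in1, pr1_in1K, pr2_in2K, pr1_in2K, pr2_in1K).

Lemma bip_src_eta (W : C) (v : mor (bip A B) W) :
  v = v ∘ in1 ∘ pr1 + v ∘ in2 ∘ pr2.
Proof. by rewrite -!hcompA -hcompDr bip_id hcompm1. Qed.

Lemma bip_src_ext (W : C) (u v : mor (bip A B) W) :
  u ∘ in1 = v ∘ in1 -> u ∘ in2 = v ∘ in2 -> u = v.
Proof. by move=> e1 e2; rewrite (bip_src_eta u) (bip_src_eta v) e1 e2. Qed.

Lemma bip_tgt_eta (W : C) (v : mor W (bip A B)) :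
  v = in1 ∘ (pr1 ∘ v) + in2 ∘ (pr2 ∘ v).
Proof. by rewrite !hcompA -hcompDl bip_id hcomp1m. Qed.

Lemma bip_tgt_ext (W : C) (u v : mor W (bip A B)) :
  pr1 ∘ u = pr1 ∘ v -> pr2 ∘ u = pr2 ∘ v -> u = v.
Proof. by move=> e1 e2; rewrite (bip_tgt_eta u) (bip_tgt_eta v) e1 e2. Qed.

Lemma bip_zero : is_zero_ob A -> is_zero_ob B -> is_zero_ob (bip A B).
Proof.
move=> [A0 A0'] [B0 B0']; split=> W v.
  by apply: bip_src_ext; rewrite hcomp0m; [exact: A0|exact: B0].
by apply: bip_tgt_ext; rewrite hcompm0; [exact: A0'|exact: B0'].
Qed.

End Biproduct.

Section Horseshoe.
Variables (C : addCat) (X Z : complex C) (w : hom_fam Z X).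
Hypotheses (w_deg : hom_deg (-1) w) (w_d : hom_d (-1) w = 0).

(** The sign in degree -1 is negative, so a cycle anticommutes with the differentials; [w_deg]
    covers the remaining triples of degrees. *)
Lemma twist_anticomm i j k : cx_d X j k ∘ w i j + w j k ∘ cx_d Z i j = 0.
Proof.
have [->|jk] := eqVneq j (k + 1); last first.
  by rewrite cx_shape // hcomp0m w_deg ?hcomp0m ?addr0 //; lia.
have [->|ij] := eqVneq i (k + 1 + 1); last first.
  by rewrite w_deg ?hcompm0 ?cx_shape ?hcompm0 ?addr0 //; lia.
have := congr1 (fun u : hom_fam Z X => u (k + 1 + 1) k) w_d.
by rewrite /hom_d hf0E addrK mulrNz opprK.
Qed.

Definition twist_ob (i : int) : C := bip (X i) (Z i).

(** Up to shift and signs, the differential of the mapping cone of [w]. *)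
Definition twist_d i j : mor (twist_ob i) (twist_ob j) :=
  (in1 ∘ cx_d X i j) ∘ pr1 + (in1 ∘ w i j + in2 ∘ cx_d Z i j) ∘ pr2.

Lemma twist_d_in1 i j : twist_d i j ∘ in1 = in1 ∘ cx_d X i j.
Proof. by rewrite hcompDl -!hcompA !bipK !hcompm0 hcompm1 addr0. Qed.

Lemma twist_d_in2 i j : twist_d i j ∘ in2 = in1 ∘ w i j + in2 ∘ cx_d Z i j.
Proof. by rewrite hcompDl -!hcompA !bipK !hcompm0 hcompm1 add0r. Qed.

Lemma twist_shape i j : i != j + 1 -> twist_d i j = 0.
Proof.
move=> ij; rewrite /twist_d !cx_shape // w_deg; last by lia.
by rewrite !hcompm0 addr0 !hcomp0m addr0.
Qed.

Lemma twist_dd i j k : twist_d j k ∘ twist_d i j = 0.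
Proof.
apply: bip_src_ext; rewrite hcomp0m -hcompA.
  by rewrite twist_d_in1 hcompA twist_d_in1 -hcompA cx_dd hcompm0.
rewrite twist_d_in2 hcompDr !hcompA twist_d_in1 twist_d_in2 hcompDl -!hcompA.
by rewrite cx_dd hcompm0 addr0 -hcompDr twist_anticomm hcompm0.
Qed.

Definition twist : complex C := Complex twist_shape twist_dd.

Definition twist_in : chain_map X twist.
Proof. by exists (fun i => @in1 C (X i) (Z i)) => i j; exact: twist_d_in1. Defined.

Definition twist_pr : chain_map twist Z.
Proof.
exists (fun i => @pr2 C (X i) (Z i)) => i j; apply: bip_src_ext; rewrite -!hcompA.
  by rewrite twist_d_in1 !bipK hcompm0.
by rewrite twist_d_in2 hcompDr !bipK add0r hcompm1.
Defined.

Section Augmentation.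
Variables (A B D : C) (x : mor A B) (y : mor B D).
Variables (iotaX : mor A (X 0)) (iotaZ : mor D (Z 0)) (sigma : mor B (X 0)).
Hypothesis sigma_x : sigma ∘ x = iotaX.
Hypothesis sigma_w : cx_d X 0 (0 - 1) ∘ sigma + w 0 (0 - 1) ∘ iotaZ ∘ y = 0.
Hypothesis iotaZ_d : cx_d Z 0 (0 - 1) ∘ iotaZ = 0.

(** The augmentation of the horseshoe lemma; [sigma_w] is the vanishing of the [X]-component of its
    differential. *)
Definition twist_iota : mor B (twist 0) := in1 ∘ sigma + in2 ∘ (iotaZ ∘ y).

Lemma twist_iota_d : cx_d twist 0 (0 - 1) ∘ twist_iota = 0.
Proof.
rewrite /twist_iota hcompDr !hcompA twist_d_in1 twist_d_in2 !hcompDl.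
rewrite -!(hcompA in2) iotaZ_d hcomp0m hcompm0 addr0 -!(hcompA in1).
by rewrite -hcompDr sigma_w hcompm0.
Qed.

(** The twisted differential is triangular: the [X]-component is solved first, then the
    [Z]-component after subtracting the contribution of [w]. *)
Lemma twist_acyclic (J : C) :
  short_exact (fun h : mor D J => h ∘ y) (fun h : mor B J => h ∘ x) ->
  acyclic_into J iotaX -> acyclic_into J iotaZ -> acyclic_into J twist_iota.
Proof.
move=> [y_inj xy_ex x_surj] [X_surj X_ex0 X_ex] [Z_surj Z_ex0 Z_ex].
have out i k (v : mor (twist_ob i) J) (a : mor (X k) J) (c : mor (Z k) J) :
    v ∘ in1 = a ∘ cx_d X i k -> v ∘ in2 = a ∘ w i k + c ∘ cx_d Z i k ->
    (a ∘ pr1 + c ∘ pr2) ∘ twist_d i k = v.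
  move=> va vc; apply: bip_src_ext; rewrite -hcompA.
    rewrite twist_d_in1 va hcompDl -!hcompA !bipK hcompm0 addr0 //.
  rewrite twist_d_in2 vc hcompDl !hcompDr -!hcompA !bipK.
  by rewrite !hcompm0 addr0 add0r.
split=> [n|v v0|i i0 v v0].
(* [a] extends n x over X_0; the rest n - a sigma vanishes on [A], hence comes from [D] and extends
   to Z_0. *)
- have [a aP] := X_surj (n ∘ x).
  have [c cP] : exists c, c ∘ y = n - a ∘ sigma.
    by apply/xy_ex; rewrite hcompBl -hcompA sigma_x aP subrr.
  have [c' c'P] := Z_surj c; exists (a ∘ pr1 + c' ∘ pr2).
  rewrite /twist_iota hcompDl !hcompDr -!hcompA !bipK !hcompm0 addr0 add0r.
  by rewrite hcompA c'P cP addrC subrK.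
- have vE : v ∘ in1 ∘ sigma + v ∘ in2 ∘ (iotaZ ∘ y) = 0.
    by rewrite -v0 /twist_iota hcompDr !hcompA.
  (* On [A], v in1 sigma x equals - v in2 iotaZ y x, which vanishes by exactness. *)
  have /X_ex0[a aP] : v ∘ in1 ∘ iotaX = 0.
    have /xy_ex : exists c, c ∘ y = v ∘ in2 ∘ (iotaZ ∘ y).
      by exists (v ∘ in2 ∘ iotaZ); rewrite hcompA.
    move=> e; rewrite -sigma_x hcompA; move/eqP: vE; rewrite addr_eq0 => /eqP ->.
    by rewrite hcompNl e oppr0.
  (* Precomposition with [y] is injective, so this is checked on [B], where [sigma_w] replaces w
     iotaZ y by - d sigma. *)
  have /Z_ex0[c cP] : (v ∘ in2 - a ∘ w 0 (0 - 1)) ∘ iotaZ = 0.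
    apply: y_inj; rewrite hcomp0m -hcompA hcompBl -!hcompA.
    move/eqP: sigma_w; rewrite [X in X == _]addrC addr_eq0 -hcompA => /eqP ->.
    by rewrite hcompNr opprK (hcompA a) aP [LHS]addrC (hcompA v).
  by exists (a ∘ pr1 + c ∘ pr2); apply: out; rewrite ?aP // cP addrC subrK.
have va : v ∘ in1 ∘ cx_d X (i + 1) i = 0.
  by rewrite -hcompA -twist_d_in1 hcompA v0 hcomp0m.
have [a aP] := X_ex i i0 _ va.
have vc : v ∘ in1 ∘ w (i + 1) i + v ∘ in2 ∘ cx_d Z (i + 1) i = 0.
  by rewrite -!hcompA -hcompDr -twist_d_in2 hcompA v0 hcomp0m.
have [|c cP] := Z_ex i i0 (v ∘ in2 - a ∘ w i (i - 1)).
  rewrite hcompBl -(hcompA a); have /eqP := twist_anticomm (i + 1) i (i - 1).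
  rewrite [X in X == _]addrC addr_eq0 => /eqP ->.
  by rewrite hcompNr opprK (hcompA a) aP [LHS]addrC.
by exists (a ∘ pr1 + c ∘ pr2); apply: out; rewrite ?aP // cP addrC subrK.
Qed.

End Augmentation.
End Horseshoe.

(** * Long exact sequences *)

Lemma sq_class_eq0 (V : zmodType) (Z B : subgroup V) v :
  Z v -> sq_class Z B v = 0 <-> B v.
Proof.
move=> Zv; have class0 : sq_class Z B 0 = 0.
  by rewrite -[X in sq_class _ _ X](subrr 0) sq_classB ?subrr //; exact: sg_0.
by rewrite -class0 -[X in B X]subr0; apply: sq_class_eq => //; exact: sg_0.
Qed.

(** Moves exactness of induced maps to representatives, where the splittings can be applied. *)
Lemma sq_map_exact (V1 V2 V3 : zmodType) (Z1 B1 : subgroup V1) (Z2 B2 : subgroup V2)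
    (Z3 B3 : subgroup V3) (F : {additive V1 -> V2}) (G : {additive V2 -> V3})
    (FZ : forall v, Z1 v -> Z2 (F v)) (FB : forall v, B1 v -> B2 (F v))
    (GZ : forall v, Z2 v -> Z3 (G v)) (GB : forall v, B2 v -> B3 (G v)) :
  (forall v, Z2 v -> B3 (G v) <-> exists u, Z1 u /\ B2 (v - F u)) ->
  exact_at (sq_map FZ FB) (sq_map GZ GB).
Proof.
move=> FG h; have Zv := sq_reprP h; rewrite -(sq_reprK h).
move: (sq_repr h) Zv => v Zv; rewrite /sq_map /= (sq_funE GZ GB) //.
split=> [/(sq_class_eq0 _ (GZ _ Zv))/(FG _ Zv)[u [Zu uv]]|[c]].
  exists (sq_class Z1 B1 u); rewrite (sq_funE FZ FB) //.
  by apply/esym/sq_class_eq => //; exact: FZ.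
rewrite -(sq_reprK c) => /esym; rewrite (sq_funE FZ FB); last exact: sq_reprP.
move=> /(sq_class_eq _ Zv (FZ _ (sq_reprP c))) uv.
apply/sq_class_eq0; first exact: GZ.
by apply/FG => //; exists (sq_repr c); split=> //; exact: sq_reprP.
Qed.

(** * The long exact sequence of a degreewise split sequence of Hom complexes *)

Section SplitExact.
Variables (C : addCat) (X1 Y1 X2 Y2 X3 Y3 : complex C).
Variables (F : {additive hom_fam X1 Y1 -> hom_fam X2 Y2})
          (G : {additive hom_fam X2 Y2 -> hom_fam X3 Y3})
          (R : {additive hom_fam X2 Y2 -> hom_fam X1 Y1})
          (S : {additive hom_fam X3 Y3 -> hom_fam X2 Y2}).
Hypotheses
  (F_deg : forall m u, hom_deg m u -> hom_deg m (F u))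
  (G_deg : forall m u, hom_deg m u -> hom_deg m (G u))
  (R_deg : forall m u, hom_deg m u -> hom_deg m (R u))
  (S_deg : forall m u, hom_deg m u -> hom_deg m (S u))
  (F_van : forall u, vanishes_below u -> vanishes_below (F u))
  (G_van : forall u, vanishes_below u -> vanishes_below (G u))
  (R_van : forall u, vanishes_below u -> vanishes_below (R u))
  (S_van : forall u, vanishes_below u -> vanishes_below (S u))
  (F_d : forall m u, hom_d m (F u) = F (hom_d m u))
  (G_d : forall m u, hom_d m (G u) = G (hom_d m u))
  (RF : forall u, R (F u) = u) (GS : forall u, G (S u) = u)
  (FR_SG : forall u, F (R u) + S (G u) = u).

Variables
  (FZ : forall n u, cocycles X1 Y1 n u -> cocycles X2 Y2 n (F u))
  (FB : forall n u, coboundaries X1 Y1 n u -> coboundaries X2 Y2 n (F u))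
  (GZ : forall n u, cocycles X2 Y2 n u -> cocycles X3 Y3 n (G u))
  (GB : forall n u, coboundaries X2 Y2 n u -> coboundaries X3 Y3 n (G u)).

Lemma split_FR u : F (R u) = u - S (G u).
Proof. by rewrite -[X in X - _]FR_SG addrK. Qed.

Lemma split_GF u : G (F u) = 0.
Proof.
have := FR_SG (F u); rewrite RF -[RHS]addr0 => /addrI/(congr1 G).
by rewrite GS raddf0.
Qed.

Lemma cocyclesS (X Y : complex C) n (u : hom_fam X Y) : cocycles X Y (n + 1) u <->
  hom_deg (- n - 1) u /\ vanishes_below (hom_d (- n - 1) u).
Proof. by rewrite /= /cocycle opprD. Qed.

Lemma coboundariesS (X Y : complex C) n (u : hom_fam X Y) :
  coboundaries X Y (n + 1) u <-> hom_deg (- n - 1) u /\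
    exists w : hom_fam X Y, hom_deg (- n) w /\ vanishes_below (u - hom_d (- n) w).
Proof. by rewrite /= /coboundary opprD subrK. Qed.

Section Connecting.
Variable n : int.

(** The snake construction: lift by [S], differentiate, retract by [R]. The splittings [R] and [S]
    need not commute with the differentials. *)
Definition split_conn (u : hom_fam X3 Y3) : hom_fam X1 Y1 := R (hom_d (- n) (S u)).

Lemma split_conn_additive : zmod_morphism split_conn.
Proof. by move=> u v; rewrite /split_conn (raddfB S) hom_dB (raddfB R). Qed.
HB.instance Definition _ :=
  GRing.isZmodMorphism.Build _ _ split_conn split_conn_additive.

(** Measures the failure of [S] to be a chain map. Since [R] retracts [F], identities for
    [split_conn] can be checked after [F]. *)
Lemma split_connE u : F (split_conn u) = hom_d (- n) (S u) - S (hom_d (- n) u).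
Proof. by rewrite split_FR -G_d GS. Qed.

Lemma split_conn_deg u : hom_deg (- n) u -> hom_deg (- n - 1) (split_conn u).
Proof. by move=> du; apply: R_deg; apply: hom_d_deg; exact: S_deg. Qed.

(** The differential of the image of u is - R d S d u, which vanishes below because d u does. *)
Lemma split_conn_cocycle u :
  cocycles X3 Y3 n u -> cocycles X1 Y1 (n + 1) (split_conn u).
Proof.
move=> [du zu]; apply/cocyclesS; split; first exact: split_conn_deg.
rewrite -[hom_d _ _]RF -F_d split_connE hom_dB hom_dd sub0r raddfN.
by apply: vanishes_belowN; apply: R_van; apply: hom_d_vanishes; exact: S_van.
Qed.

Lemma split_conn_coboundary u :
  coboundaries X3 Y3 n u -> coboundaries X1 Y1 (n + 1) (split_conn u).
Proof.
move=> [du [w [dw uw]]]; apply/coboundariesS; split; first exact: split_conn_deg.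
(* The connecting map sends d w to d(- R d S w): after [F], both become d S d w. *)
exists (- R (hom_d (- n + 1) (S w))); split.
  apply: hom_degN; apply: R_deg.
  by apply: hom_d_degS; exact: S_deg.
have -> : split_conn u - hom_d (- n) (- R (hom_d (- n + 1) (S w))) =
    split_conn (u - hom_d (- n + 1) w).
  rewrite split_conn_additive; congr (_ - _); rewrite -[LHS]RF -[RHS]RF; congr (R _).
  rewrite -F_d raddfN split_connE split_FR -G_d GS.
  by rewrite hom_ddS raddf0 subr0 opprB hom_dB hom_ddS subr0.
by apply: R_van; apply: hom_d_vanishes; exact: S_van.
Qed.

Lemma split_exact1 v : cocycles X2 Y2 n v ->
  coboundaries X3 Y3 n (G v) <->
  exists u, cocycles X1 Y1 n u /\ coboundaries X2 Y2 n (v - F u).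
Proof.
move=> [dv zv]; split=> [[_ [w [dw vw]]]|[u [_ /GB]]]; last first.
  by rewrite raddfB split_GF subr0.
have dSw : hom_deg (- n) (hom_d (- n + 1) (S w)).
  by apply: hom_d_degS; exact: S_deg.
(* G(d S w) = d w, so subtracting the boundary d S w from v leaves an element that [G] sends to one
   vanishing below. *)
pose u := R (v - hom_d (- n + 1) (S w)).
have vFu : v - F u = S (G v - hom_d (- n + 1) w) + hom_d (- n + 1) (S w).
  by rewrite /u split_FR (raddfB G) -G_d GS opprB addrCA subKr.
have du : hom_deg (- n) u by apply: R_deg; exact: hom_degB.
exists u; split; split=> //.
- have FuE : F u = v - (S (G v - hom_d (- n + 1) w) + hom_d (- n + 1) (S w)).
    by rewrite -vFu subKr.
  rewrite -[hom_d _ _]RF -F_d FuE opprD addrA hom_dB.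
  rewrite hom_ddS subr0 hom_dB.
  by apply: R_van; apply: vanishes_belowB => //; apply: hom_d_vanishes; exact: S_van.
- by apply: hom_degB => //; exact: F_deg.
exists (S w); split; first exact: S_deg.
by rewrite vFu addrK; exact: S_van.
Qed.

Lemma split_exact2 v : cocycles X3 Y3 n v ->
  coboundaries X1 Y1 (n + 1) (split_conn v) <->
  exists u, cocycles X2 Y2 n u /\ coboundaries X3 Y3 n (v - G u).
Proof.
move=> [dv zv]; split=> [/coboundariesS[_ [w [dw vw]]]|[u [[du zu] vu]]].
  (* The differential of S v - F w is S d v + F(conn v - d w), where both terms vanish below. *)
  exists (S v - F w); split; last first.
    by rewrite raddfB GS split_GF subr0 subrr; exact: coboundary0.
  split; first by apply: hom_degB; [exact: S_deg|exact: F_deg].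
  rewrite hom_dB F_d -[hom_d _ (S v)](subrK (S (hom_d (- n) v))) -split_connE.
  rewrite addrAC -raddfB -[S _]opprK; apply: vanishes_belowB; first exact: F_van.
  by apply: vanishes_belowN; exact: S_van.
(* It remains to treat G u: from S G u = u - F R u follows conn(G u) = R d u - d R u, and R d u
   vanishes below. *)
have -> : split_conn v = split_conn (v - G u) - (- split_conn (G u)).
  by rewrite opprK -(raddfD split_conn) subrK.
apply: sg_B; first exact: split_conn_coboundary.
apply/coboundariesS; split.
  by apply: hom_degN; apply: split_conn_deg; exact: G_deg.
exists (R u); split; first exact: R_deg.
have SGu : S (G u) = u - F (R u) by rewrite split_FR subKr.
rewrite /split_conn SGu hom_dB F_d raddfB RF opprB addrAC subrr sub0r.
by apply: vanishes_belowN; exact: R_van.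
Qed.

Lemma split_exact3 v : cocycles X1 Y1 (n + 1) v ->
  coboundaries X2 Y2 (n + 1) (F v) <->
  exists u, cocycles X3 Y3 n u /\ coboundaries X1 Y1 (n + 1) (v - split_conn u).
Proof.
move=> /cocyclesS[dv zv]; split=> [/coboundariesS[_ [w [dw vw]]]|[u [[du zu] vu]]].
  (* As G F = 0, d(G w) = G(d w - F v) vanishes below. Moreover v - conn(G w) = R(F v - d w) + d R
     w. *)
  exists (G w); split.
    split; first exact: G_deg.
    rewrite G_d -[X in vanishes_below X]opprK -[- G _]add0r -(split_GF v) -raddfB.
    by apply: vanishes_belowN; exact: G_van.
  apply/coboundariesS; split.
    by apply: hom_degB => //; apply: split_conn_deg; exact: G_deg.
  exists (R w); split; first exact: R_deg.
  have SGw : S (G w) = w - F (R w) by rewrite split_FR subKr.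
  rewrite /split_conn SGw hom_dB F_d raddfB RF opprB -addrA addrAC subrr sub0r.
  by rewrite -[v]RF -raddfB; exact: R_van.
(* By [split_connE], F(conn u) is the boundary of S u up to S d u, which vanishes below. *)
have -> : F v = F (v - split_conn u) - (- F (split_conn u)).
  by rewrite opprK -(raddfD F) subrK.
apply: sg_B; first exact: FB.
apply/coboundariesS; split.
  by apply: hom_degN; apply: F_deg; exact: split_conn_deg.
exists (- S u); split; first by apply: hom_degN; exact: S_deg.
rewrite split_connE opprB -[- S u]sub0r hom_dB hom_d0 sub0r opprK subrK.
exact: S_van.
Qed.

End Connecting.

Lemma split_long_exact :
  exists conn : forall n,
    {additive quot_cohomology X3 Y3 n -> quot_cohomology X1 Y1 (n + 1)},
  forall n,
    [/\ exact_at (sq_map (@FZ n) (@FB n)) (sq_map (@GZ n) (@GB n)),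
        exact_at (sq_map (@GZ n) (@GB n)) (conn n)
      & exact_at (conn n) (sq_map (@FZ (n + 1)) (@FB (n + 1)))].
Proof.
exists (fun n => sq_map (@split_conn_cocycle n) (@split_conn_coboundary n)) => n.
by split; apply: sq_map_exact => v; [exact: split_exact1|exact: split_exact2|
  exact: split_exact3].
Qed.

End SplitExact.

Section FamilyMaps.
Variables (C : addCat) (X X' Y Y' : complex C).

(** Unlike [precomp], this allows families that are not chain maps, such as the degreewise
    splittings of the twisted sum. *)
Definition fam_pre (f : forall i, mor (X' i) (X i)) (u : hom_fam X Y) : hom_fam X' Y :=
  fun i j => u i j ∘ f i.

Lemma fam_pre_additive f : zmod_morphism (fam_pre f).
Proof. by move=> u v; apply: hf_ext => i j; exact: hcompBl. Qed.
HB.instance Definition _ f :=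
  GRing.isZmodMorphism.Build _ _ (fam_pre f) (fam_pre_additive f).

Lemma fam_pre_deg f m u : hom_deg m u -> hom_deg m (fam_pre f u).
Proof. by move=> du i j ij; rewrite /fam_pre du // hcomp0m. Qed.

Lemma fam_pre_vanishes f u : vanishes_below u -> vanishes_below (fam_pre f u).
Proof. by move=> [k uk]; exists k => i j ik; rewrite /fam_pre uk // hcomp0m. Qed.

Definition fam_post (f : forall j, mor (Y j) (Y' j)) (u : hom_fam X Y) : hom_fam X Y' :=
  fun i j => f j ∘ u i j.

Lemma fam_post_additive f : zmod_morphism (fam_post f).
Proof. by move=> u v; apply: hf_ext => i j; exact: hcompBr. Qed.
HB.instance Definition _ f :=
  GRing.isZmodMorphism.Build _ _ (fam_post f) (fam_post_additive f).

Lemma fam_post_deg f m u : hom_deg m u -> hom_deg m (fam_post f u).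
Proof. by move=> du i j ij; rewrite /fam_post du // hcompm0. Qed.

Lemma fam_post_vanishes f u : vanishes_below u -> vanishes_below (fam_post f u).
Proof. by move=> [k uk]; exists k => i j ik; rewrite /fam_post uk // hcompm0. Qed.

End FamilyMaps.

(** * The two long exact sequences of the twisted sum *)

Section TwistExact.
Variables (C : addCat) (X Z W : complex C) (w : hom_fam Z X).
Hypotheses (w_deg : hom_deg (-1) w) (w_d : hom_d (-1) w = 0).

Lemma twist_pre_long_exact : exists conn : forall n,
    {additive quot_cohomology X W n -> quot_cohomology Z W (n + 1)},
  forall n,
    [/\ exact_at (quot_cohomology_pre W (twist_pr w_deg w_d) n)
                 (quot_cohomology_pre W (twist_in w_deg w_d) n),
        exact_at (quot_cohomology_pre W (twist_in w_deg w_d) n) (conn n)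
      & exact_at (conn n) (quot_cohomology_pre W (twist_pr w_deg w_d) (n + 1))].
Proof.
pose T := twist w_deg w_d.
(* Mapping into [W] reverses the sequence X -> T -> Z, which [in2] and [pr1] split in each
   degree. *)
apply: (@split_long_exact C Z W T W X W
  (precomp (Y := W) (twist_pr w_deg w_d)) (precomp (Y := W) (twist_in w_deg w_d))
  (@fam_pre C T Z W (fun i => @in2 C (X i) (Z i)))
  (@fam_pre C X T W (fun i => @pr1 C (X i) (Z i)))).
- exact: precomp_deg.
- exact: precomp_deg.
- exact: fam_pre_deg.
- exact: fam_pre_deg.
- exact: precomp_vanishes.
- exact: precomp_vanishes.
- exact: fam_pre_vanishes.
- exact: fam_pre_vanishes.
- exact: precomp_d.
- exact: precomp_d.
- move=> u; apply: hf_ext => i j.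
  by rewrite /= /fam_pre /precomp /= -hcompA pr2_in2 hcompm1.
- move=> u; apply: hf_ext => i j.
  by rewrite /= /fam_pre /precomp /= -hcompA pr1_in1 hcompm1.
- move=> u; apply: hf_ext => i j.
  by rewrite hfDE /= /fam_pre /precomp /= addrC -bip_src_eta.
Qed.

Lemma twist_post_long_exact : exists conn : forall n,
    {additive quot_cohomology W Z n -> quot_cohomology W X (n + 1)},
  forall n,
    [/\ exact_at (quot_cohomology_post W (twist_in w_deg w_d) n)
                 (quot_cohomology_post W (twist_pr w_deg w_d) n),
        exact_at (quot_cohomology_post W (twist_pr w_deg w_d) n) (conn n)
      & exact_at (conn n) (quot_cohomology_post W (twist_in w_deg w_d) (n + 1))].
Proof.
pose T := twist w_deg w_d.
apply: (@split_long_exact C W X W T W Z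
  (postcomp (X := W) (twist_in w_deg w_d)) (postcomp (X := W) (twist_pr w_deg w_d))
  (@fam_post C W T X (fun i => @pr1 C (X i) (Z i)))
  (@fam_post C W Z T (fun i => @in2 C (X i) (Z i)))).
- exact: postcomp_deg.
- exact: postcomp_deg.
- exact: fam_post_deg.
- exact: fam_post_deg.
- exact: postcomp_vanishes.
- exact: postcomp_vanishes.
- exact: fam_post_vanishes.
- exact: fam_post_vanishes.
- exact: postcomp_d.
- exact: postcomp_d.
- move=> u; apply: hf_ext => i j.
  by rewrite /= /fam_post /postcomp /= hcompA pr1_in1 hcomp1m.
- move=> u; apply: hf_ext => i j.
  by rewrite /= /fam_post /postcomp /= hcompA pr2_in2 hcomp1m.
- move=> u; apply: hf_ext => i j.
  by rewrite hfDE /= /fam_post /postcomp /= -bip_tgt_eta.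
Qed.

End TwistExact.

(** Only the middle terms change, along inverse isomorphisms; the connecting maps are kept. *)
Lemma long_exact_transfer (A T T' B : int -> zmodType)
    (f : forall n, {additive A n -> T n}) (g : forall n, {additive T n -> B n})
    (f' : forall n, {additive A n -> T' n}) (g' : forall n, {additive T' n -> B n})
    (p : forall n, {additive T n -> T' n}) (q : forall n, {additive T' n -> T n}) :
  (forall n, cancel (p n) (q n)) -> (forall n, cancel (q n) (p n)) ->
  (forall n a, f' n a = p n (f n a)) -> (forall n t, g' n (p n t) = g n t) ->
  (exists conn : forall n, {additive B n -> A (n + 1)%R}, forall n,
    [/\ exact_at (f n) (g n), exact_at (g n) (conn n)
      & exact_at (conn n) (f (n + 1))]) ->
  exists conn : forall n, {additive B n -> A (n + 1)%R}, forall n,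
    [/\ exact_at (f' n) (g' n), exact_at (g' n) (conn n)
      & exact_at (conn n) (f' (n + 1))].
Proof.
move=> pK qK f'E g'E [conn connP]; exists conn => n; have [fg gc cf] := connP n.
split=> [t'|b|a].
- rewrite -(qK n t') g'E; split=> [/fg[a <-]|[a]]; first by exists a; rewrite f'E.
  by rewrite f'E => /(can_inj (pK n)) ta; apply/fg; exists a.
- split=> [/gc[t <-]|[t' <-]]; first by exists (p n t); rewrite g'E.
  by rewrite -(qK n t') g'E; apply/gc; exists (q n t').
- split=> [|/cf fa0]; last by rewrite f'E fa0 raddf0.
  rewrite f'E -[X in _ = X](raddf0 (p (n + 1))) => /(can_inj (pK (n + 1))).
  by move/cf.
Qed.

(** * Coresolutions relative to a proper class *)

Section Coresolutions.
Variables (C : extriCat) (xi : triClass C).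

Lemma xi_injective_zero (J : C) : is_zero_ob J -> xi_injective xi J.
Proof.
move=> [_ J0] A B D x y d _; split=> [h h' _|v|v].
- by rewrite (J0 _ h) (J0 _ h').
- by split=> _; [exists 0; rewrite hcomp0m [RHS]J0|exact: J0].
- by exists 0; rewrite hcomp0m [RHS]J0.
Qed.

Lemma xi_injective_bip (J J' : C) :
  xi_injective xi J -> xi_injective xi J' -> xi_injective xi (bip J J').
Proof.
move=> hJ hJ' A B D x y d xyd.
have [inj ex surj] := hJ _ _ _ _ _ _ xyd; have [inj' ex' surj'] := hJ' _ _ _ _ _ _ xyd.
split=> [h h' hh'|v|v].
- by apply: bip_tgt_ext; [apply: inj|apply: inj']; rewrite -!hcompA hh'.
- split=> [v0|[u uv]].
    have /ex[a aP] : (pr1 ∘ v) ∘ x = 0 by rewrite -hcompA v0 hcompm0.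
    have /ex'[b bP] : (pr2 ∘ v) ∘ x = 0 by rewrite -hcompA v0 hcompm0.
    exists (in1 ∘ a + in2 ∘ b).
    by rewrite hcompDl -!hcompA aP bP -bip_tgt_eta.
  apply: bip_tgt_ext; rewrite hcompm0 hcompA.
    by apply/ex; exists (pr1 ∘ u); rewrite -uv hcompA.
  by apply/ex'; exists (pr2 ∘ u); rewrite -uv hcompA.
- have [[a aP] [b bP]] := (surj (pr1 ∘ v), surj' (pr2 ∘ v)).
  exists (in1 ∘ a + in2 ∘ b).
  by rewrite hcompDl -!hcompA aP bP -bip_tgt_eta.
Qed.

(** Write d as g f. If v g f = 0 then v g = 0, so v factors through the next f, and the factor
    extends along the next g, each time because [J] is xi-injective. *)
Lemma xi_exact_extend (X : int -> C) (d : forall i j, mor (X i) (X j)) (J : C) n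
    (v : mor (X n) J) :
  xi_exact xi d -> xi_injective xi J -> v ∘ d (n + 1) n = 0 ->
  exists t : mor (X (n - 1)) J, t ∘ d n (n - 1) = v.
Proof.
move=> [K [g [f [t [tri dE]]]]] hJ.
have [k nk] : exists k, n = k + 1 by exists (n - 1); rewrite subrK.
rewrite nk in v *; rewrite addrK !dE hcompA => v0.
have [f_inj _ _] := hJ _ _ _ _ _ _ (tri (k + 1 + 1)).
have [_ gf_ex _] := hJ _ _ _ _ _ _ (tri (k + 1)).
have [_ _ g_surj] := hJ _ _ _ _ _ _ (tri k).
have /gf_ex[psi psiP] : v ∘ g (k + 1) = 0 by apply: f_inj; rewrite v0 hcomp0m.
have [theta thetaP] := g_surj psi.
by exists theta; rewrite hcompA thetaP.
Qed.

(** The map g_n f_(n+1) lies in the image of precomposition with f_(n+1), so exactness of mor (-)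
    X_n on the triangle makes it vanish on g_(n+1). *)
Lemma xi_exact_dd (X : int -> C) (d : forall i j, mor (X i) (X j)) n :
  xi_exact xi d -> xi_injective xi (X n) -> d (n + 1) n ∘ d (n + 1 + 1) (n + 1) = 0.
Proof.
move=> [K [g [f [t [tri dE]]]]] hX; rewrite !dE hcompA.
have [_ gf_ex _] := hX _ _ _ _ _ _ (tri (n + 1)).
have -> : g n ∘ f (n + 1) ∘ g (n + 1) = 0 by apply/gf_ex; exists (g n).
by rewrite hcomp0m.
Qed.

Section OneCoresolution.
Variables (N : C) (I : coresolution xi N).

Lemma cr_injective j : xi_injective xi (I j).
Proof.
case: (ltP 0 j) => [/cr_zero-/(_ _ _ _ I)/xi_injective_zero//|]; exact: cr_inj.
Qed.

(** [N] sits in degree 1 of the augmented complex, so at [n = -1] its two differentials compute to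
    those in the statement. *)
Lemma cr_d_iota : cx_d I 0 (0 - 1) ∘ cr_iota I = 0.
Proof. exact: (xi_exact_dd (n := -1) (cr_exact I) (cr_injective (-1))). Qed.

Lemma cr_acyclic (J : C) : xi_injective xi J -> acyclic_into J (cr_iota I).
Proof.
move=> hJ; have ext := xi_exact_extend (cr_exact I) hJ; split=> [n|v v0|i i0 v v0].
- exact: (ext 1 n (hcompm0 _ _)).
- exact: (ext 0 v v0).
case: i i0 v v0 => // p _ v v0.
(* [aug_d] at an unknown degree [k] reduces only after a case split; in degree 1 it is zero here,
   the other degree being negative. *)
have toaug k : v ∘ cx_d I k (Negz p) = 0 ->
    v ∘ (aug_d (cx_d I) (cr_iota I) k (Negz p) : mor _ (I (Negz p))) = 0.
  by case: k => [[|[|k]]|k] // _; exact: hcompm0.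
have fromaug k (t : mor (aug_ob N I k) J) : exists t' : mor (I k) J,
    t' ∘ cx_d I (Negz p) k = t ∘ aug_d (cx_d I) (cr_iota I) (Negz p) k.
  case: k t => [[|[|k]]|k] t; try by exists t.
  by exists 0; rewrite hcomp0m; apply/esym/hcompm0.
have [t <-] := ext (Negz p) v (toaug _ v0); exact: fromaug.
Qed.

End OneCoresolution.

(** * The horseshoe and the long exact sequences of a triangle in xi *)

Section Triangle.
Variables (A B D : C) (x : mor A B) (y : mor B D) (delta : ext (ec_ext C) D A).
Hypothesis hdelta : xi x y delta.
Variables (IA : coresolution xi A) (IB : coresolution xi B) (ID : coresolution xi D).
Variables (lx : lifting x IA IB) (ly : lifting y IB ID).

Lemma cr_iota_triangle : cr_iota ID ∘ (y ∘ x) = 0.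
Proof.
have [_ xy_ex _] := cr_injective ID 0 hdelta.
by rewrite hcompA; apply/xy_ex; exists (cr_iota ID).
Qed.

(** [p] and [q] are comparison maps over the identity of [B]; each homotopy holds because both sides
    agree on the augmentation. *)
Lemma horseshoe : exists (w : hom_fam ID IA) (w_deg : hom_deg (-1) w)
    (w_d : hom_d (-1) w = 0) (p : chain_map (twist w_deg w_d) IB)
    (q : chain_map IB (twist w_deg w_d)),
  [/\ homotopic (cm_comp p q) (cm_id IB), homotopic (cm_comp q p) (cm_id _),
      homotopic (cm_comp p (twist_in w_deg w_d)) lx
    & homotopic (cm_comp ly p) (twist_pr w_deg w_d)] /\
  [/\ homotopic (cm_comp q lx) (twist_in w_deg w_d)
    & homotopic (cm_comp (twist_pr w_deg w_d) q) ly].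
Proof.
have [_ xy_ex x_surj] := cr_injective IA 0 hdelta.
have [_ xy_ex' _] := cr_injective IA (0 - 1) hdelta.
(* Degree -2 is where the cycle condition on [mu] is tested. *)
have [y_inj _ _] := cr_injective IA (-1 - 1) hdelta.
have [sigma sigma_x] := x_surj (cr_iota IA).
(* d sigma factors through [y] because d sigma x = d iota_A = 0. *)
have [mu muP] : exists mu, mu ∘ y = - (cx_d IA 0 (0 - 1) ∘ sigma).
  by apply/xy_ex'; rewrite hcompNl -hcompA sigma_x cr_d_iota oppr0.
(* [w] is a cycle extending [mu] along the augmentation of [D], so its contribution cancels d sigma
   on [B]. *)
have [||||w [w_deg w_d w0]] :=
  @hom_lift C D ID IA (cr_iota ID) (-1) 0 mu (@cr_zero _ _ _ ID).
- by move=> j; apply: cr_acyclic; exact: cr_injective.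
- by [].
- exact: hom_d0.
- rewrite hf0E hcomp0m; apply: (y_inj).
  by rewrite hcomp0m -hcompA muP hcompNr hcompA cx_dd hcomp0m oppr0.
have sigma_w : cx_d IA 0 (0 - 1) ∘ sigma + w 0 (0 - 1) ∘ cr_iota ID ∘ y = 0.
  by rewrite w0 muP subrr.
pose T := twist w_deg w_d.
pose iotaT := twist_iota w_deg w_d y (cr_iota ID) sigma : mor B (T 0).
have T0 i : 0 < i -> is_zero_ob (T i).
  by move=> i0; apply: bip_zero; exact: cr_zero.
have T_inj i : xi_injective xi (T i).
  by apply: xi_injective_bip; exact: cr_injective.
have T_acyclic J : xi_injective xi J -> acyclic_into J iotaT.
  move=> hJ; apply: (twist_acyclic _ _ sigma_x sigma_w) (cr_acyclic _ hJ)
    (cr_acyclic _ hJ).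
  exact: (hJ _ _ _ _ _ _ hdelta).
have iotaT_x : iotaT ∘ x = in1 ∘ cr_iota IA.
  rewrite /iotaT /twist_iota hcompDl -!hcompA sigma_x.
  by rewrite cr_iota_triangle hcompm0 addr0.
have iotaT_y : pr2 ∘ iotaT = cr_iota ID ∘ y.
  by rewrite /iotaT /twist_iota hcompDr !bipK add0r.
have [p p0] := comparison_exists T0 (fun j => T_acyclic _ (cr_injective IB j))
  (cr_d_iota IB).
have [q q0] := comparison_exists (@cr_zero _ _ _ IB) (fun j => cr_acyclic IB (T_inj j))
  (twist_iota_d w_deg w_d sigma_w (cr_d_iota ID)).
exists w, w_deg, w_d, p, q; split; split.
- apply: (comparison_unique (@cr_zero _ _ _ IB)
    (fun j => cr_acyclic IB (cr_injective IB j))).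
  by rewrite /= -hcompA q0 p0 hcomp1m.
- apply: (comparison_unique T0 (fun j => T_acyclic _ (T_inj j))).
  by rewrite /= -hcompA p0 q0 hcomp1m.
- apply: (comparison_unique (@cr_zero _ _ _ IA)
    (fun j => cr_acyclic IA (cr_injective IB j))).
  by rewrite /= -hcompA -iotaT_x hcompA p0 lf_comm.
- apply: (comparison_unique T0 (fun j => T_acyclic _ (cr_injective ID j))).
  by rewrite /= -hcompA p0 lf_comm iotaT_y.
- apply: (comparison_unique (@cr_zero _ _ _ IA)
    (fun j => cr_acyclic IA (T_inj j))).
  by rewrite /= -hcompA lf_comm hcompA q0 iotaT_x.
apply: (comparison_unique (@cr_zero _ _ _ IB)
    (fun j => cr_acyclic IB (cr_injective ID j))).
by rewrite /= -hcompA q0 iotaT_y lf_comm.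
Qed.

Lemma xxt_pre_long_exact (N : C) (IN : coresolution xi N) :
  exists conn : forall n : int, {additive xxt n IA IN -> xxt (n + 1) ID IN},
  forall n : int,
     [/\ exact_at (xxt_pre n ly IN) (xxt_pre n lx IN),
         exact_at (xxt_pre n lx IN) (conn n)
       & exact_at (conn n) (xxt_pre (n + 1) ly IN)].
Proof.
have [w [w_deg [w_d [p [q [[pq qp _ _] [q_in pr_q]]]]]]] := horseshoe.
(* By contravariance, [q : IB -> T] induces the map from the groups of the twisted sum to those of
   [IB]. *)
pose q' n := quot_cohomology_pre IN q n; pose p' n := quot_cohomology_pre IN p n.
apply: (@long_exact_transfer _ _ _ _ _ _ _ _ q' p' _ _ _ _
  (twist_pre_long_exact IN w_deg w_d)).
- move=> n c; rewrite -quot_cohomology_pre_comp.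
  by rewrite (quot_cohomology_pre_homotopic qp) quot_cohomology_pre_id.
- move=> n c; rewrite -quot_cohomology_pre_comp.
  by rewrite (quot_cohomology_pre_homotopic pq) quot_cohomology_pre_id.
- move=> n c; rewrite -quot_cohomology_pre_comp.
  by rewrite (quot_cohomology_pre_homotopic pr_q).
- move=> n c; rewrite -quot_cohomology_pre_comp.
  by rewrite (quot_cohomology_pre_homotopic q_in).
Qed.

Lemma xxt_post_long_exact (M : C) (IM : coresolution xi M) :
  exists conn : forall n : int, {additive xxt n IM ID -> xxt (n + 1) IM IA},
  forall n : int,
     [/\ exact_at (xxt_post n IM lx) (xxt_post n IM ly),
         exact_at (xxt_post n IM ly) (conn n)
       & exact_at (conn n) (xxt_post (n + 1) IM lx)].
Proof.
have [w [w_deg [w_d [p [q [[pq qp p_in pr_p] _]]]]]] := horseshoe.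
(* In the covariant variable it is [p] that leads from the twisted sum to [IB]. *)
pose q' n := quot_cohomology_post IM q n; pose p' n := quot_cohomology_post IM p n.
apply: (@long_exact_transfer _ _ _ _ _ _ _ _ p' q' _ _ _ _
  (twist_post_long_exact IM w_deg w_d)).
- move=> n c; rewrite -quot_cohomology_post_comp.
  by rewrite (quot_cohomology_post_homotopic qp) quot_cohomology_post_id.
- move=> n c; rewrite -quot_cohomology_post_comp.
  by rewrite (quot_cohomology_post_homotopic pq) quot_cohomology_post_id.
- move=> n c; rewrite -quot_cohomology_post_comp.
  by rewrite (quot_cohomology_post_homotopic p_in).
- move=> n c; rewrite -quot_cohomology_post_comp.
  by rewrite (quot_cohomology_post_homotopic pr_p).
Qed.

End Triangle.
End Coresolutions.

Theorem theorem3p14 (C : extriCat) (xi : triClass C)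
    (hWIC : WIC C) (hxi : proper_class xi)
    (hproj : enough_xi_projectives xi) (hinj : enough_xi_injectives xi)
    (A B D : C) (x : mor A B) (y : mor B D) (delta : ext (ec_ext C) D A)
    (hdelta : xi A B D x y delta) :
  (forall (N : C), finite_Gid xi N ->
   forall (IA : coresolution xi A) (IB : coresolution xi B) (ID : coresolution xi D)
          (IN : coresolution xi N) (lx : lifting x IA IB) (ly : lifting y IB ID),
   exists conn : forall n : int, {additive xxt n IA IN -> xxt (n + 1) ID IN},
   forall n : int,
     [/\ exact_at (xxt_pre n ly IN) (xxt_pre n lx IN),
         exact_at (xxt_pre n lx IN) (conn n)
       & exact_at (conn n) (xxt_pre (n + 1) ly IN)])
  /\
  (finite_Gid xi A -> finite_Gid xi D ->
   forall (M : C)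
          (IA : coresolution xi A) (IB : coresolution xi B) (ID : coresolution xi D)
          (IM : coresolution xi M) (lx : lifting x IA IB) (ly : lifting y IB ID),
   exists conn : forall n : int, {additive xxt n IM ID -> xxt (n + 1) IM IA},
   forall n : int,
     [/\ exact_at (xxt_post n IM lx) (xxt_post n IM ly),
         exact_at (xxt_post n IM ly) (conn n)
       & exact_at (conn n) (xxt_post (n + 1) IM lx)]).
Proof.
split=> [N _|_ _ M] IA IB ID ? lx ly.
  exact: (xxt_pre_long_exact hdelta).
exact: (xxt_post_long_exact hdelta).
Qed.
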